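(* Let $(x_*(\cdot),u_*(\cdot))\in\mathscr A^{\mathcal S}_{\rm adm}\cap\mathscr A^{\mathcal S}_{\rm Lip}$. If $(x_*(\cdot),u_*(\cdot))$ is a strong local minimum of the problem $$J(x(\cdot),u(\cdot))=\int_{t_0}^{t_1} f(t,x(t),u(t))\,dt+S(x(t_1))\to\inf,\qquad \dot x(t)=\varphi(t,x(t),u(t)),\ x(t_0)=x_0,\qquad u(t)\in U,$$ then there exists a vector function $p(\cdot)\in PC_1([t_0,t_1],\mathbb R^n)$ such that (a) the adjoint equation $\dot p(t)=-H^{\mathcal S}_x(t,x_*(t),u_*(t),p(t))$ holds on $[t_0,t_1]$; (b) at $t=t_1$ the transversality condition $p(t_1)=-S'(x_*(t_1))$ holds; (c) at almost all points $t\in[t_0,t_1]$ the maximum condition $$H^{\mathcal S}(t,x_*(t),u_*(t),p(t))=\max_{u\in U}H^{\mathcal S}(t,x_*(t),u,p(t))$$ holds.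
   Context: Function spaces. A function on $[a,b]$ is piecewise continuous if it is continuous except at finitely many points $a<s_1<\dots<s_N<b$, where both one-sided limits exist and are finite, and its values at the $s_i$ are chosen so that it is right-continuous. It is piecewise continuously differentiable if it is continuous on $[a,b]$, continuously differentiable on $(a,s_1),(s_1,s_2),\dots,(s_N,b)$ for finitely many such points, and its derivative is a piecewise continuous function on $[a,b]$, right-continuous at the $s_i$; $\dot x$ denotes this derivative. $PC([a,b],\mathbb R^n)$ and $PC_1([a,b],\mathbb R^n)$ are the corresponding spaces (componentwise); $PC([a,b],U)$ is the set of piecewise continuous functions with values in $U$. Data: $[t_0,t_1]$ a given interval, $x_0\in\mathbb R^n$, $\emptyset\neq U\subseteq\mathbb R^m$, $f:\mathbb R\times\mathbb R^n\times\mathbb R^m\to\mathbb R$, $\varphi:\mathbb R\times\mathbb R^n\times\mathbb R^m\to\mathbb R^n$, and $S:\mathbb R^n\to\mathbb R$ continuously differentiable. $\mathscr A^{\mathcal S}_{\rm Lip}$ is the set of all pairs $(x(\cdot),u(\cdot))$ for which there is $\gamma>0$ such that $f(t,x,u)$ and $\varphi(t,x,u)$ are, on the set of all $(t,x,u)\in\mathbb R\times\mathbb R^n\times\mathbb R^m$ with $t\in[t_0,t_1]$, $\|x-x(t)\|<\gamma$, $u\in\mathbb R^m$, jointly continuous in all variables and continuously differentiable with respect to $x$. $\mathscr A^{\mathcal S}_{\rm adm}$ (admissible processes) is the set of all $(x(\cdot),u(\cdot))\in PC_1([t_0,t_1],\mathbb R^n)\times PC([t_0,t_1],U)$ satisfying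 $\dot x(t)=\varphi(t,x(t),u(t))$, $x(t_0)=x_0$. An admissible process $(x_*(\cdot),u_*(\cdot))$ is a strong local minimum if there is $\varepsilon>0$ such that $J(x(\cdot),u(\cdot))\ge J(x_*(\cdot),u_*(\cdot))$ for all $(x(\cdot),u(\cdot))\in\mathscr A^{\mathcal S}_{\rm adm}$ with $\|x(\cdot)-x_*(\cdot)\|_\infty<\varepsilon$ (sup norm on $[t_0,t_1]$). Pontryagin function: $H^{\mathcal S}(t,x,u,p)=\langle p,\varphi(t,x,u)\rangle-f(t,x,u)$. *)

(* Defs.v *)
From HB Require Import structures.
From mathcomp Require Import all_boot all_order all_algebra.
From mathcomp Require Import all_classical all_reals all_analysis.
Import Order.TTheory GRing.Theory Num.Theory.
Import numFieldNormedType.Exports.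

Set Implicit Arguments.
Unset Strict Implicit.
Unset Printing Implicit Defensive.

Local Open Scope classical_set_scope.
Local Open Scope ring_scope.

(* Functions on [a, b] are total functions on R; only their values on [a, b]
   matter. At a and b continuity is one-sided, whence the [within] filter. *)
Definition piecewise_continuous_off (R : realType) (a b : R) (s : seq R)
    (g : R -> R) : Prop :=
  [/\ forall t, t \in s -> a < t < b,
      forall t, t \in `[a, b] -> t \notin s ->
        g @ within [set` `[a, b]] (nbhs t) --> g t
    & forall t, t \in s -> cvg (g @ t^'-) /\ g @ t^'+ --> g t].

Definition PC (R : realType) (k : nat) (a b : R) (g : R -> 'rV[R]_k) : Prop :=
  forall i : 'I_k,
    exists s : seq R, piecewise_continuous_off a b s (fun t => g t 0 i).

Definition pc_derivative (R : realType) (a b : R) (x xdot : R -> R) : Prop :=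
  {within [set` `[a, b]], continuous x} /\
  exists s : seq R,
    piecewise_continuous_off a b s xdot /\
    forall t, a < t < b -> t \notin s -> is_derive t 1 x (xdot t).

(* x is in PC_1([a, b], R^k) and xdot is its derivative. For a < b, x determines
   xdot on all of [a, b]: xdot is the classical derivative off finitely many
   points, right-continuous on [a, b[ and left-continuous at b. *)
Definition PC1 (R : realType) (k : nat) (a b : R) (x xdot : R -> 'rV[R]_k)
    : Prop :=
  forall i : 'I_k,
    pc_derivative a b (fun t => x t 0 i) (fun t => xdot t 0 i).

Definition grad (R : realType) (n : nat) (g : 'rV[R]_n -> R) (x : 'rV[R]_n)
    : 'rV[R]_n :=
  \row_i 'D_(delta_mx 0 i) g x.

Definition continuously_differentiable (R : realType) (n : nat)
    (g : 'rV[R]_n -> R) : Prop :=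
  (forall x, differentiable g x) /\ continuous (grad g).

(* The functions g(t, x, u) that are jointly continuous on A and have there a
   derivative in x which is also continuous jointly in (t, x, u). *)
Definition C0_C1x_on (R : realType) (n m : nat) (V : normedModType R)
    (A : set (R * 'rV[R]_n * 'rV[R]_m))
    (g : R -> 'rV[R]_n -> 'rV[R]_m -> V) : Prop :=
  [/\ {within A, continuous (fun z => g z.1.1 z.1.2 z.2)},
      forall t x u, A (t, x, u) -> differentiable (fun y => g t y u) x
    & forall i : 'I_n, {within A, continuous
        (fun z => 'D_(delta_mx 0 i) (fun y => g z.1.1 y z.2) z.1.2)}].

Definition A_Lip (R : realType) (n m : nat) (t0 t1 : R)
    (f : R -> 'rV[R]_n -> 'rV[R]_m -> R)
    (phi : R -> 'rV[R]_n -> 'rV[R]_m -> 'rV[R]_n)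
    : set ((R -> 'rV[R]_n) * (R -> 'rV[R]_m)) :=
  [set w | exists gamma : R, 0 < gamma /\
    let tube := [set z : R * 'rV[R]_n * 'rV[R]_m |
                  z.1.1 \in `[t0, t1] /\ `|z.1.2 - w.1 z.1.1| < gamma] in
    C0_C1x_on tube f /\ C0_C1x_on tube phi].

Definition A_adm (R : realType) (n m : nat) (t0 t1 : R) (x0 : 'rV[R]_n)
    (U : set 'rV[R]_m) (phi : R -> 'rV[R]_n -> 'rV[R]_m -> 'rV[R]_n)
    : set ((R -> 'rV[R]_n) * (R -> 'rV[R]_m)) :=
  [set w | [/\ exists xdot : R -> 'rV[R]_n,
                 PC1 t0 t1 w.1 xdot /\
                 forall t, t \in `[t0, t1] -> xdot t = phi t (w.1 t) (w.2 t),
               w.1 t0 = x0,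
               PC t0 t1 w.2
             & forall t, t \in `[t0, t1] -> U (w.2 t)]].

Definition J (R : realType) (n m : nat) (t0 t1 : R)
    (f : R -> 'rV[R]_n -> 'rV[R]_m -> R) (S : 'rV[R]_n -> R)
    (w : (R -> 'rV[R]_n) * (R -> 'rV[R]_m)) : R :=
  \int[lebesgue_measure]_(t in [set` `[t0, t1]]) f t (w.1 t) (w.2 t)
  + S (w.1 t1).

Definition sup_norm (R : realType) (n : nat) (a b : R) (x : R -> 'rV[R]_n)
    : R :=
  sup [set `|x t| | t in [set` `[a, b]]].

Definition strong_local_minimum (R : realType) (n m : nat) (t0 t1 : R)
    (x0 : 'rV[R]_n) (U : set 'rV[R]_m)
    (f : R -> 'rV[R]_n -> 'rV[R]_m -> R)
    (phi : R -> 'rV[R]_n -> 'rV[R]_m -> 'rV[R]_n) (S : 'rV[R]_n -> R)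
    (w : (R -> 'rV[R]_n) * (R -> 'rV[R]_m)) : Prop :=
  exists eps : R, 0 < eps /\
    forall v, A_adm t0 t1 x0 U phi v ->
      sup_norm t0 t1 (fun t => v.1 t - w.1 t) < eps ->
      J t0 t1 f S w <= J t0 t1 f S v.

Definition pontryagin (R : realType) (n m : nat)
    (f : R -> 'rV[R]_n -> 'rV[R]_m -> R)
    (phi : R -> 'rV[R]_n -> 'rV[R]_m -> 'rV[R]_n)
    (t : R) (x : 'rV[R]_n) (u : 'rV[R]_m) (p : 'rV[R]_n) : R :=
  \sum_i p 0 i * phi t x u 0 i - f t x u.

Definition is_maximum (R : realType) (A : set R) (y : R) : Prop :=
  A y /\ ubound A y.

(* Main.v *)
(** Needle variation: replace the optimal control by a constant [v] on
    [[tau, tau + h[]. The perturbed trajectory [x] exists and satisfies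
    [|x - xs| <= C h]; both facts come out of one Picard iteration started at
    [xs], run with the right-hand side extended by clamping [x - xs] to the tube
    and contracting for an exponentially weighted norm, so that neither a
    continuation argument nor Gronwall's lemma is needed. With [p] solving the
    adjoint equation, integrating the derivative of [<p, x - xs>] shows that the
    cost changes by [h (H(tau, us) - H(tau, v)) + o(h)], without linearising the
    flow. Since this must be nonnegative, [us] maximises [H] at [tau]. All
    integrals are handled as antiderivatives off a finite set. *)

Require Import Defs.
From HB Require Import structures.
From mathcomp Require Import all_boot all_order all_algebra.
From mathcomp Require Import all_classical all_reals all_analysis.
From mathcomp Require Import measurable_realfun.
From mathcomp Require Import ring lra.
Import Order.TTheory GRing.Theory Num.Theory.
Import numFieldNormedType.Exports.

Set Implicit Arguments.
Unset Strict Implicit.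
Unset Printing Implicit Defensive.

Local Open Scope classical_set_scope.
Local Open Scope ring_scope.

(** * Antiderivatives off a finite set *)

(** The orders of magnitude decide the argument. Off the needle, the density of the cost increment
    is minus the first-order remainder of the Pontryagin function in [x], at most [eta * C * h] with
    [eta] at will, which is [o(h)] over the whole interval. On the needle the error is merely
    [O(h)], but it is integrated over a length [h]. A gain of order [h] at [tau] therefore cannot be
    cancelled. For this the remainder must be small uniformly in [t]. The data are regular only in
    an open tube with unbounded controls, so compactness has to be created: a narrower tube, and a
    bound [M] on the controls involved. Beyond the tube nothing is known of [phi], and this is what
    forces the clamping. The exceptional points form an explicit list because the needle adds its
    two ends to those of [us] and [xs], and because a finite list can be removed by cutting the
    interval, which lets the mean value theorem do the work of integral inequalities. *)

Definition bounded_continuous_off (R : realType) (a b : R) (s : seq R)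
    (g : R -> R) : Prop :=
  (exists M : R, forall t, t \in `[a, b] -> `|g t| <= M) /\
  (forall t, a < t < b -> t \notin s -> {for t, continuous g}).

(** Continuity on the whole closed interval forbids jumps at the points of [s], so [g] determines
    the increments of [G]. With [s] explicit, functions with different exceptional points are
    brought to a common list by enlarging it. *)
Definition primitive_off (R : realType) (a b : R) (s : seq R) (G g : R -> R)
    : Prop :=
  {within `[a, b], continuous G} /\
  (forall t, a < t < b -> t \notin s -> is_derive t 1 G (g t)).

Section primitives.
Context {R : realType}.
Implicit Types (a b c : R) (s : seq R) (G H g h : R -> R).

Lemma primitive_offW a b c d s G g : a <= c -> d <= b ->
  primitive_off a b s G g -> primitive_off c d s G g.
Proof.
move=> ac db [cG dG]; split.
  apply: continuous_subspaceW cG; apply: subset_itv; rewrite bnd_simp//.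
by move=> t /andP[ct td] ts; apply: dG => //;
  rewrite (le_lt_trans ac)//= (lt_le_trans td).
Qed.

Lemma primitive_off_sub a b s s' G g : {subset s <= s'} ->
  primitive_off a b s G g -> primitive_off a b s' G g.
Proof.
move=> ss [cG dG]; split=> // t tab ts; apply: dG => //.
by apply: contra ts; exact: ss.
Qed.

(** For empty [s] this is the mean value theorem. A point of [s] inside []a, b[] is removed by
    cutting there, [G] being continuous up to the cut. All later comparisons of antiderivatives
    reduce to this one. *)
Lemma primitive_off_nondecreasing a b s G g : a <= b ->
  primitive_off a b s G g -> (forall t, a < t < b -> t \notin s -> 0 <= g t) ->
  G a <= G b.
Proof.
elim: s a b => [|c s IH] a b ab pG g0.
  have [cG dG] := pG.
  have dab x : x \in `]a, b[ -> is_derive x 1 G (g x).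
    by rewrite in_itv/= => xab; exact: dG.
  have [<- //|anb] := eqVneq a b.
  have {}ab : a < b by rewrite lt_neqAle anb.
  have [t tab e] := @MVT R G g a b ab dab cG.
  rewrite -subr_ge0 e mulr_ge0//; last by rewrite subr_ge0 ltW.
  by apply: g0 => //; move: tab; rewrite in_itv.
have [/andP[ac cb]|/negP cab] := boolP (a < c < b); last first.
  have nc t : a < t < b -> t \notin s -> t \notin c :: s.
    by move=> tab ts; rewrite inE negb_or ts andbT; apply/eqP => tc;
      apply: cab; rewrite -tc.
  apply: (IH a b ab).
    by case: pG => cG dG; split => // t tab ts; apply: dG => //; exact: nc.
  by move=> t tab ts; apply: g0 => //; exact: nc.
have nc t : a < t < c \/ c < t < b -> t \notin s -> (a < t < b) * (t \notin c
  :: s).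
  case=> /andP[h1 h2] ts; split.
  - by rewrite h1 (lt_trans h2).
  - by rewrite inE (lt_eqF h2) ts.
  - by rewrite h2 (lt_trans ac).
  - by rewrite inE (gt_eqF h1) ts.
apply: (@le_trans _ _ (G c)).
  have [cG dG] := primitive_offW (lexx a) (ltW cb) pG.
  apply: IH; [exact: ltW| |].
    by split => // t tab ts; have [? ?] := nc t (or_introl tab) ts; exact: dG.
  by move=> t tab ts; have [? ?] := nc t (or_introl tab) ts; exact: g0.
have [cG dG] := primitive_offW (ltW ac) (lexx b) pG.
apply: IH; [exact: ltW| |].
  by split => // t tab ts; have [? ?] := nc t (or_intror tab) ts; exact: dG.
by move=> t tab ts; have [? ?] := nc t (or_intror tab) ts; exact: g0.
Qed.

Lemma primitive_offB a b s G H g h :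
  primitive_off a b s G g -> primitive_off a b s H h ->
  primitive_off a b s (G \- H) (g \- h).
Proof.
move=> [cG dG] [cH dH]; split.
  by move=> x; apply: continuousB; [exact: cG|exact: cH].
by move=> t tab ts; apply: is_deriveB; [exact: dG|exact: dH].
Qed.

Lemma primitive_offN a b s G g :
  primitive_off a b s G g -> primitive_off a b s (\- G) (\- g).
Proof.
move=> [cG dG]; split.
  by move=> x; apply: continuousN; exact: cG.
by move=> t tab ts; apply: is_deriveN; exact: dG.
Qed.

Lemma primitive_off_linear a b s (k : R) :
  primitive_off a b s (fun t => k * t) (cst k).
Proof.
have dk (t : R) : is_derive t 1 (fun t => k * t) k.
  by apply: is_derive_eq; rewrite /GRing.scale/= mulr1.
split=> // t; apply: continuous_subspaceT => {}t.
by apply/differentiable_continuous/derivable1_diffP; have [] := dk t.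
Qed.

Lemma primitive_off_le a b s G H g h : a <= b ->
  primitive_off a b s G g -> primitive_off a b s H h ->
  (forall t, a < t < b -> t \notin s -> g t <= h t) -> G b - G a <= H b - H a.
Proof.
move=> ab pG pH gh.
have le1 : (H \- G) a <= (H \- G) b.
  apply: primitive_off_nondecreasing ab (primitive_offB pH pG) _ => t tab ts.
  by rewrite /= subr_ge0 gh.
by move: le1 => /=; lra.
Qed.

(** The absolute value on the right allows [t] on either side of [c], so that equations can be
    solved from either end of the interval. *)
Lemma primitive_off_norm_le a b s G H g h (t c : R) :
  t \in `[a, b] -> c \in `[a, b] ->
  primitive_off a b s G g -> primitive_off a b s H h ->
  (forall t, a < t < b -> t \notin s -> `|g t| <= h t) ->
  `|G t - G c| <= `|H t - H c|.
Proof.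
wlog: t c / c <= t => [hw tab cab pG pH gh|].
  have [ct|/ltW tc] := leP c t; first exact: hw.
  by rewrite distrC [leRHS]distrC; exact: hw.
move=> ct; rewrite !in_itv/= => /andP[at_ tb] /andP[ac cb] pG pH gh.
have {}pG := primitive_offW ac tb pG.
have {}pH := primitive_offW ac tb pH.
have {}gh x : c < x < t -> x \notin s -> `|g x| <= h x.
  move=> /andP[cx xt]; apply: gh.
  by rewrite (le_lt_trans ac)//= (lt_le_trans xt).
apply: le_trans (ler_norm _); rewrite ler_norml; apply/andP; split.
  rewrite lerNl opprB.
  have -> : G c - G t = (\- G) t - (\- G) c by rewrite /= opprK addrC.
  apply: (primitive_off_le ct (primitive_offN pG) pH) => x xab xs.
  by rewrite (le_trans (ler_norm _))//= normrN gh.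
apply: (primitive_off_le ct pG pH) => x xab xs.
by rewrite (le_trans (ler_norm _))// gh.
Qed.

End primitives.

Section integration.
Context {R : realType}.
Implicit Types (a b c : R) (s : seq R) (G H g h : R -> R).
Notation mu := (@lebesgue_measure R).

(** Up to the finite set [E], on which every function is measurable, the interval is the open set
    [D], on which [g] is continuous; boundedness does the rest. *)
Lemma bounded_continuous_off_integrable a b s g :
  bounded_continuous_off a b s g -> mu.-integrable `[a, b] (EFin \o g).
Proof.
move=> [[M gM] cg].
pose D := `]a, b[ `\` [set` s]; pose E := `[a, b] `&` [set` b :: a :: s].
have fs : finite_set [set` b :: a :: s] by exact: finite_seq.
have fE : finite_set E by apply: sub_finite_set fs => x [].
have mall (A : set R) : finite_set A -> measurable A.
  move=> fA; apply: countable_measurable; first by move=> t;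
    exact: measurable_set1.
  exact: finite_set_countable.
have oD : open D.
  rewrite /D setDE; apply: openI; first exact: interval_open.
  apply: closed_openC.
  by have /accessible_finite_set_closed :=
    @hausdorff_accessible _ (@Rhausdorff R); apply; exact: finite_seq.
have DE : [set` `[a, b]] = D `|` E.
  apply/seteqP; split => x /=.
    rewrite in_itv/= => /andP[ax xb].
    have [xE|xE] := boolP (x \in b :: a :: s).
      by right; split => //=; rewrite in_itv/= ax.
    move: xE; rewrite !inE !negb_or => /and3P[nb na ns].
    left; split => /=; last exact/negP.
    by rewrite in_itv/= !lt_neqAle ax xb nb eq_sym na.
  by case=> [[]|[]//] /=; rewrite !in_itv/= => /andP[/ltW-> /ltW->].
apply: measurable_bounded_integrable; first exact: measurable_itv.
- by rewrite /= lebesgue_measure_itv/=; case: ifP => //; rewrite -EFinD ltry.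
- rewrite DE; apply/measurable_funU; [exact: open_measurable|exact: mall|split].
    apply: open_continuous_measurable_fun => //.
    move=> x; rewrite inE => -[/=]; rewrite in_itv/= => xab /negP xs.
    exact: cg.
  by move=> mE Y mY; apply: mall; apply: sub_finite_set fE => x [].
apply: filterS (nbhs_pinfty_ge (num_real M)) => x Mx t /= tab.
by rewrite (le_trans (gM _ tab)).
Qed.

Definition integral_from a g t : R := \int[mu]_(u in `[a, t]) g u.

Lemma integral_from_primitive a b s g : a <= b -> bounded_continuous_off a b s
  g ->
  primitive_off a b s (integral_from a g) g.
Proof.
move=> ab pg; have ig := bounded_continuous_off_integrable pg.
split; first exact: parameterized_integral_continuous.
move=> t /andP[at_ tb] ts.
have [_ /(_ t)] := pg; rewrite at_ tb => /(_ isT ts) ct.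
have [dt <-] := continuous_FTC1_closed tb ig at_ ct.
by rewrite derive1E; exact/derivableP.
Qed.

Lemma integral_from_base a g : integral_from a g a = 0.
Proof. by rewrite /integral_from set_itv1 Rintegral_set1. Qed.

End integration.

(** * Global Picard iteration *)

(** The sum of the positive bounds dominates each of them; the added 1 keeps it positive when
    [k = 0]. *)
Lemma fin_upper (R : realType) (k : nat) (P : 'I_k -> R -> Prop) :
  (forall i, exists2 B, 0 < B & P i B) ->
  (forall i B B', B <= B' -> P i B -> P i B') ->
  exists2 B, 0 < B & forall i, P i B.
Proof.
move=> exB mono.
have /choice[B BP] : forall i, exists B, 0 < B /\ P i B.
  by move=> i; have [B] := exB i; exists B.
have S0 (Q : pred 'I_k) : 0 <= \sum_(i | Q i) B i.
  by apply: sumr_ge0 => i _; rewrite ltW//; case: (BP i).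
exists (\sum_i B i + 1) => [|i]; first by rewrite ltr_wpDl.
apply: mono (BP i).2; rewrite (bigD1 i)//= -addrA lerDl addr_ge0//; exact: S0.
Qed.

Lemma rVBE (R : realType) (n : nat) (v w : 'rV[R]_n) i :
  (v - w) 0 i = v 0 i - w 0 i.
Proof. by rewrite !mxE. Qed.

Lemma rV_norm_le (R : realType) (n : nat) (v : 'rV[R]_n) (M : R) : 0 <= M ->
  (forall i, `|v 0 i| <= M) -> `|v| <= M.
Proof.
move=> M0 vM; rewrite /Num.norm/= mx_normrE.
by apply: bigmax_le => // -[i j] _ /=; rewrite ord1.
Qed.

Lemma le_rV_norm (R : realType) (n : nat) (v : 'rV[R]_n) i : `|v 0 i| <= `|v|.
Proof.
by rewrite [leRHS]/Num.norm/= mx_normrE; exact: (le_bigmax _ _ (0, i)).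
Qed.

Lemma cvg_rVP (R : realType) (n : nat) (T : Type) (F : set_system T)
    {FF : Filter F} (x : T -> 'rV[R]_n) (y : 'rV[R]_n) :
  x @ F --> y <-> forall i, (fun t => x t 0 i) @ F --> y 0 i.
Proof.
split=> [xy i|xy].
  apply/cvgrPdist_le => e e0; move/cvgrPdist_le : xy => /(_ e e0).
  apply: filterS => t; apply: le_trans; have := le_rV_norm (y - x t) i.
  by rewrite !mxE.
apply/cvgrPdist_le => e e0; near=> t; apply: rV_norm_le; first exact: ltW.
near: t; apply: filter_forall => i.
move/cvgrPdist_le : (xy i) => /(_ e e0); apply: filterS => t.
by rewrite !mxE.
Unshelve. all: by end_near. Qed.

Lemma half_power_small (R : realType) (D e : R) : 0 < e ->
  exists k, D / 2 ^+ k < e.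
Proof.
move=> e0; exists (Num.bound (D / e)).
by rewrite ltr_pdivrMr ?exprn_gt0// mulrC -ltr_pdivrMr//; exact: upper_nthrootP.
Qed.

(** The intervals of radius [2 * D / 2 ^+ k] about [u k] are nested, and the supremum of their left
    ends lies in all of them. This gives the limit together with its rate. *)
Lemma half_power_limit (R : realType) (u : nat -> R) (D : R) :
  (forall k, `|u k.+1 - u k| <= D / 2 ^+ k) ->
  exists l, forall k, `|u k - l| <= 2 * D / 2 ^+ k.
Proof.
move=> uD.
pose v k := u k - 2 * D / 2 ^+ k; pose w k := u k + 2 * D / 2 ^+ k.
have E k : 2 * D / 2 ^+ k.+1 = D / 2 ^+ k.
  by rewrite exprS invfM mulrACA divff// mul1r.
have E2 k : 2 * D / 2 ^+ k = D / 2 ^+ k + D / 2 ^+ k by ring.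
have D0 k : 0 <= D / 2 ^+ k by rewrite (le_trans _ (uD k)).
have vS k : v k <= v k.+1.
  rewrite /v E E2; have := uD k; rewrite ler_norml => /andP[]; lra.
have wS k : w k.+1 <= w k.
  rewrite /w E E2; have := uD k; rewrite ler_norml => /andP[]; lra.
have vw j k : v j <= w k.
  have vm : {homo v : i j / (i <= j)%N >-> i <= j} by apply: homo_leq => //;
    exact: le_trans.
  have wm : {homo w : i j / (i <= j)%N >-> j <= i}.
    by apply: homo_leq => // x y z xy yz; exact: le_trans yz xy.
  apply: le_trans (vm _ _ (leq_maxl j k)) _.
  apply: le_trans _ (wm _ _ (leq_maxr j k)).
  by rewrite /v /w lerD2l; have := D0 (maxn j k); rewrite E2; lra.
exists (sup (range v)) => k.
have vub : has_ubound (range v) by exists (w 0%N) => _ [j _ <-].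
have h1 : v k <= sup (range v) by apply: ub_le_sup => //; exists k.
have h2 : sup (range v) <= w k.
  by apply: ge_sup; [exists (v 0%N), 0%N | move=> _ [j _ <-]].
by move: h1 h2; rewrite /v /w ler_norml; lra.
Qed.

Section picard.
Context {R : realType} {n : nat}.
Variables (a b : R) (s : seq R) (F : R -> 'rV[R]_n -> 'rV[R]_n) (L : R).
Variables (c sg : R) (x1 : 'rV[R]_n).
Hypotheses (L0 : 0 < L) (cab : c \in `[a, b]) (sg2 : sg * sg = 1)
  (sgP : forall t, t \in `[a, b] -> 0 <= sg * (t - c)).
Hypothesis HF : forall x : R -> 'rV[R]_n, {within `[a, b], continuous x} ->
  forall i, bounded_continuous_off a b s (fun t => F t (x t) 0 i).
Hypothesis HL : forall t, t \in `[a, b] -> forall x y,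
  `|F t x - F t y| <= L * `|x - y|.

(* [c = a], [sg = 1] solves forwards in time, [c = b], [sg = -1] backwards; the
   map [T] below halves distances weighted by [w]. *)
Let w (t : R) := expR (2 * L * sg * (t - c)).

Let ab : a <= b.
Proof. by move: cab; rewrite in_itv/= => /andP[]; exact: le_trans. Qed.

Let w_ge1 t : t \in `[a, b] -> 1 <= w t.
Proof.
move=> tab; rewrite -expR0 ler_expR -!mulrA mulr_ge0// mulr_ge0 ?(ltW L0)//.
exact: sgP.
Qed.

Let wc : w c = 1.
Proof. by rewrite /w subrr mulr0 expR0. Qed.

Let w_le t : t \in `[a, b] -> w t <= expR (2 * L * (b - a)).
Proof.
move=> tab; rewrite ler_expR -!mulrA ler_pM2l// ler_pM2l//.
have [sg1|sgn1] : sg = 1 \/ sg = -1.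
  have /eqP : (sg - 1) * (sg + 1) = 0 by rewrite mulrBl mulrDr sg2; ring.
  by rewrite mulf_eq0 subr_eq0 addr_eq0 => /orP[]/eqP; [left|right].
- by move: tab cab; rewrite sg1 !in_itv/=; lra.
- by move: tab cab; rewrite sgn1 !in_itv/=; lra.
Qed.

(** The exponent [2 * L] in [w] is chosen for this: integrating the Lipschitz bound [L * (D * w)]
    gives back [D * w] with the factor 1/2, up to the sign [sg]. *)
Let primitive_w D : primitive_off a b s (fun t => D / 2 * sg * w t)
  (fun t => L * (D * w t)).
Proof.
have dw (t : R) : is_derive t 1 (fun t => D / 2 * sg * w t) (L * (D * w t)).
  rewrite /w; apply: is_derive_eq.
  rewrite subr0 /GRing.scale/= mulr1.
  transitivity ((sg * sg) * (L * (D * expR (2 * L * sg * (t - c))))).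
    by field.
  by rewrite sg2 mul1r.
split=> // t; apply: continuous_subspaceT => {}t.
by apply/differentiable_continuous/derivable1_diffP; have [] := dw t.
Qed.

Let T (x : R -> 'rV[R]_n) (t : R) : 'rV[R]_n :=
  \row_i (x1 0 i + (integral_from a (fun u => F u (x u) 0 i) t
                    - integral_from a (fun u => F u (x u) 0 i) c)).

Let T_primitive x : {within `[a, b], continuous x} ->
  forall i, primitive_off a b s (fun t => T x t 0 i) (fun t => F t (x t) 0 i).
Proof.
move=> cx i; have [cI dI] := integral_from_primitive ab (HF cx i).
rewrite (_ : (fun t => T x t 0 i) = cst (x1 0 i) \+ (integral_from a (fun u =>
  F u (x u) 0 i)
  \- cst (integral_from a (fun u => F u (x u) 0 i) c))); last first.
  by apply/funext => t; rewrite mxE.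
split.
  move=> t; apply: continuousD; first exact: cst_continuous.
  by apply: continuousB; [exact: cI|exact: cst_continuous].
move=> t tab ts; have := dI t tab ts => dIt.
by apply: is_derive_eq; rewrite add0r subr0.
Qed.

Let T_continuous x : {within `[a, b], continuous x} ->
  {within `[a, b], continuous (T x)}.
Proof.
move=> cx; apply/subspace_continuousP => t tab; apply/cvg_rVP => i.
by have [/subspace_continuousP/(_ t tab)] := T_primitive cx i.
Qed.

(** The two images agree at [c], where [w] is 1, so their distance at [t] is at most
    [D / 2 * (w t - 1)]. *)
Let T_contraction x y D : 0 <= D ->
  {within `[a, b], continuous x} -> {within `[a, b], continuous y} ->
  (forall t, t \in `[a, b] -> `|x t - y t| <= D * w t) ->
  forall t, t \in `[a, b] -> `|T x t - T y t| <= D / 2 * w t.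
Proof.
move=> D0 cx cy xy t tab; apply: rV_norm_le => [|i].
  by rewrite mulr_ge0 ?divr_ge0 ?expR_ge0.
have pxy := primitive_offB (T_primitive cx i) (T_primitive cy i).
have := primitive_off_norm_le tab cab pxy (primitive_w D).
move=> /(_ _)/=.
have Tc z : T z c 0 i = x1 0 i by rewrite mxE subrr addr0.
rewrite !Tc subrr subr0 -mulrBr wc.
rewrite rVBE.
move=> h; apply: le_trans (h _) _.
  move=> u uab us; have {}uab : u \in `[a, b].
    by move: uab; rewrite in_itv/= => /andP[/ltW-> /ltW->].
  rewrite -rVBE.
  apply: le_trans (le_rV_norm _ _) _; apply: le_trans (HL uab _ _) _.
  by rewrite ler_pM2l// xy.
have sg1 : `|sg| = 1.
  by apply/eqP; rewrite -sqr_norm_eq1 expr2 sg2.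
rewrite !normrM sg1 mulr1 normrV ?unitfE// !ger0_norm//; last first.
  by rewrite subr_ge0 w_ge1.
by rewrite ler_wpM2l ?divr_ge0// gerBl.
Qed.

(** The bound [C] on the first step controls the whole iteration: the halved steps add up to [2 * C]
    in the weighted distance, and the exponential removes the weight. A small first step thus gives
    a solution close to [y0]. *)
Lemma picard (y0 : R -> 'rV[R]_n) (C : R) : 0 <= C ->
  {within `[a, b], continuous y0} ->
  (forall t i, t \in `[a, b] ->
     `|x1 0 i + (integral_from a (fun u => F u (y0 u) 0 i) t
                 - integral_from a (fun u =>
                   F u (y0 u) 0 i) c) - y0 t 0 i| <= C) ->
  exists x : R -> 'rV[R]_n, [/\ {within `[a, b], continuous x}, x c = x1,
    forall i, primitive_off a b s (fun t => x t 0 i) (fun t => F t (x t) 0 i)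
    & forall t, t \in `[a, b] -> `|x t - y0 t| <= 2 * C * expR (2 * L * (b -
      a))].
Proof.
move=> C0 cy0 Hy0; pose X k := iter k T y0.
have cX k : {within `[a, b], continuous (X k)}.
  by elim: k => [//|k IH]; exact: T_continuous.
have dX k t : t \in `[a, b] -> `|X k.+1 t - X k t| <= C / 2 ^+ k * w t.
  elim: k t => [|k IH] t tab.
    rewrite expr0 divr1; apply: rV_norm_le => [|i].
      by rewrite mulr_ge0// expR_ge0.
    rewrite !mxE (le_trans (Hy0 t i tab))//.
    by rewrite -[leLHS]mulr1 ler_wpM2l// w_ge1.
  rewrite exprSr invfM mulrA.
  apply: (T_contraction _ (cX k.+1) (cX k) IH tab).
  by rewrite divr_ge0// exprn_ge0.
have ex t : t \in `[a, b] -> exists l : 'rV[R]_n,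
    forall k, `|X k t - l| <= 2 * C / 2 ^+ k * w t.
  move=> tab.
  have exi i : exists l, forall k, `|X k t 0 i - l| <= 2 * (C * w t) / 2 ^+ k.
    apply: half_power_limit => k.
    by rewrite -rVBE mulrAC; exact: le_trans (le_rV_norm _ i) (dX k t tab).
  have [l lP] := choice exi.
  exists (\row_i l i) => k; apply: rV_norm_le => [|i].
    by rewrite mulr_ge0 ?divr_ge0 ?mulr_ge0 ?exprn_ge0 ?expR_ge0.
  by rewrite rVBE [X in _ - X]mxE (le_trans (lP i k))// mulrA mulrAC.
have exx : forall t, exists l : 'rV[R]_n, t \in `[a, b] ->
    forall k, `|X k t - l| <= 2 * C / 2 ^+ k * w t.
  move=> t; have [/ex[l lP]|_] := boolP (t \in `[a, b]); first by exists l.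
  by exists 0.
have [x xP] := choice exx.
pose W := expR (2 * L * (b - a)).
have xPW k t : t \in `[a, b] -> `|X k t - x t| <= 2 * C * W / 2 ^+ k.
  move=> tab; apply: le_trans (xP t tab k) _.
  rewrite mulrAC ler_wpM2r ?invr_ge0 ?exprn_ge0//.
  by rewrite ler_wpM2l ?mulr_ge0// w_le.
have cx : {within `[a, b], continuous x}.
  apply/subspace_continuousP => t tab; apply/cvgrPdist_le => e e0.
  have e3 : 0 < e / 3 by rewrite divr_gt0.
  have [k kP] := half_power_small (2 * C * W) e3.
  have /subspace_continuousP/(_ t tab)/cvgrPdist_le/(_ _ e3) := cX k.
  rewrite /= !near_withinE; apply: filterS => t' h t'ab.
  have h1 := le_trans (xPW k t tab) (ltW kP).
  have h2 := le_trans (xPW k t' t'ab) (ltW kP).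
  have h3 := h t'ab.
  rewrite (_ : x t - x t' = (X k t - X k t') - (X k t - x t) + (X k t' - x
    t')); last first.
    by rewrite opprB !addrA; apply/rowP => i; rewrite !mxE; ring.
  have := ler_normD ((X k t - X k t') - (X k t - x t)) (X k t' - x t').
  have := ler_normB (X k t - X k t') (X k t - x t).
  lra.
have Tx t : t \in `[a, b] -> T x t = x t.
  move=> tab; apply/eqP; rewrite -subr_eq0 -normr_le0;
    apply/ler_addgt0Pl => e e0.
  rewrite addr0.
  have e2 : 0 < e / 2 by rewrite divr_gt0.
  have [k kP] := half_power_small (2 * C * W) e2.
  have h1 : `|X k.+1 t - T x t| <= 2 * C / 2 ^+ k / 2 * w t.
    apply: (T_contraction _ (cX k) cx _ tab) => [|u uab]; last exact: xP.
    by rewrite divr_ge0 ?mulr_ge0// exprn_ge0.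
  have h2 := xPW k.+1 t tab.
  have h3 : 2 * C * W / 2 ^+ k.+1 <= 2 * C * W / 2 ^+ k / 2.
    by rewrite exprSr invfM mulrA.
  have h4 : 2 * C / 2 ^+ k / 2 * w t <= 2 * C * W / 2 ^+ k / 2.
    rewrite mulrAC ler_wpM2r ?invr_ge0//
      mulrAC ler_wpM2r ?invr_ge0 ?exprn_ge0//.
    by rewrite ler_wpM2l ?mulr_ge0// w_le.
  rewrite (_ : T x t - x t = (X k.+1 t - x t) - (X k.+1 t - T x t)); last first.
    by rewrite opprB [RHS]addrC addrA subrK.
  have := ler_normB (X k.+1 t - x t) (X k.+1 t - T x t).
  lra.
(* Off [[a, b]] the limit [x] is an arbitrary default. Its image [T x] agrees with it on [[a, b]]
   and has the required derivatives because it is built from integrals. *)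
exists (T x); split.
- exact: T_continuous.
- by apply/rowP => i; rewrite mxE subrr addr0.
- move=> i; have [cT dT] := T_primitive cx i; split=> // t tab ts.
  rewrite Tx; first exact: dT.
  by move: tab; rewrite in_itv/= => /andP[/ltW-> /ltW->].
- move=> t tab; rewrite Tx// distrC; apply: le_trans (xPW 0%N t tab) _.
  by rewrite expr0 divr1.
Qed.

End picard.

(** * Uniform estimates in the tube *)

Lemma cvg_to_within (S : Type) (T : topologicalType) (F : set_system S)
    {FF : Filter F} (A : set T) (f : S -> T) (a : T) :
  (\forall r \near F, A (f r)) -> f @ F --> a -> f @ F --> within A (nbhs a).
Proof.
move=> FA fa B nB; have nB' : nbhs a [set x | A x -> B x] by exact: nB.
by apply: filterS2 FA (fa _ nB') => r Ar; exact.
Qed.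

Lemma cvg_triple (T : Type) (A B C : topologicalType) (F : set_system T)
    {FF : Filter F} (f : T -> A) (g : T -> B) (h : T -> C)
    (a : A) (b : B) (c : C) :
  f @ F --> a -> g @ F --> b -> h @ F --> c ->
  (f r, g r, h r) @[r --> F] --> (a, b, c).
Proof.
move=> fa gb hc.
apply: (@cvg_pair _ _ _ F (nbhs (a, b)) (nbhs c) _ _ _ (fun r =>
  (f r, g r)) h) => //.
exact: (@cvg_pair _ _ _ F (nbhs a) (nbhs b) _ _ _ f g).
Qed.

(** The norm of a row is the largest absolute value of its entries, whence the factor [n%:R] here
    and in the Lipschitz constants below. *)
Lemma sum_mul_le (R : realType) (n : nat) (v w : 'rV[R]_n) :
  `|\sum_i v 0 i * w 0 i| <= n%:R * `|v| * `|w|.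
Proof.
apply: le_trans (ler_norm_sum _ _ _) _.
apply: (@le_trans _ _ (\sum_(i < n) `|v| * `|w|)).
  by apply: ler_sum => i _; rewrite normrM ler_pM// le_rV_norm.
by rewrite sumr_const card_ord -[leLHS]mulr_natl mulrA.
Qed.

Section segment.
Context {R : realType} {n : nat}.
Implicit Types (g : 'rV[R]_n -> R) (x y v : 'rV[R]_n).

Lemma derive_grad g x v : differentiable g x ->
  'D_v g x = \sum_i grad g x 0 i * v 0 i.
Proof.
move=> dg; rewrite deriveE// {1}(row_sum_delta v) linear_sum.
by apply: eq_bigr => i _; rewrite linearZ mxE deriveE// mulrC.
Qed.

Lemma is_derive_line g x v (h : R) : differentiable g (x + h *: v) ->
  is_derive h 1 (fun k : R => g (x + k *: v)) ('D_v g (x + h *: v)).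
Proof.
move=> dg; have dgv : derivable g (x + h *: v) v by exact: diff_derivable.
have E : (fun k : R => k^-1 *: (g (x + (k *: 1 + h) *: v) - g (x + h *: v)))
       = (fun k => k^-1 *: (g (k *: v + (x + h *: v)) - g (x + h *: v))).
  apply/funext => k; congr (_ *: (g _ - _)).
  by rewrite scalerDl addrCA /GRing.scale/= mulr1.
split; first by rewrite /derivable E.
by rewrite /derive E.
Qed.

Lemma mean_value_rV g x y :
  (forall h : R, 0 <= h <= 1 -> differentiable g (x + h *: (y - x))) ->
  exists2 h : R, 0 <= h <= 1 &
    g y - g x = \sum_i grad g (x + h *: (y - x)) 0 i * (y - x) 0 i.
Proof.
move=> dg; pose v := y - x.
have dl (h : R) : 0 <= h <= 1 ->
    is_derive h 1 (fun k : R => g (x + k *: v)) ('D_v g (x + h *: v)).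
  by move=> h01; apply: is_derive_line; exact: dg.
have [||h h01 E] := @MVT_segment R (fun k : R => g (x + k *: v))
    (fun h => 'D_v g (x + h *: v)) 0 1 ler01.
- by move=> h; rewrite in_itv/= => /andP[h0 h1]; apply: dl; rewrite !ltW.
- apply/subspace_continuousP => h; rewrite /= in_itv/= => h01.
  apply: cvg_within_filter; apply/differentiable_continuous/derivable1_diffP.
  by have [] := dl h h01.
move: h01; rewrite in_itv/= => h01; exists h => //.
rewrite -derive_grad; last exact: dg.
move: E; rewrite scale1r scale0r addr0 subr0 mulr1 => <-.
by rewrite /v subrKC.
Qed.

End segment.

Lemma compact_norm_le (R : realType) (k : nat) (M : R) :
  compact [set v : 'rV[R]_k | `|v| <= M].
Proof.
apply: bounded_closed_compact.
  by apply: filterS (nbhs_pinfty_ge (num_real M)) => A MA v /= vM;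
    exact: le_trans MA.
rewrite (_ : [set v : 'rV[R]_k | _] = Num.norm @^-1` [set t | t <= M])//.
apply: closed_comp; last exact: closed_le.
by move=> v _; exact: norm_continuous.
Qed.

Section tube.
Context {R : realType} {n m : nat} (t0 t1 : R) (xs : R -> 'rV[R]_n) (gamma : R).
Hypothesis cxs : {within `[t0, t1], continuous xs}.
Hypothesis gamma0 : 0 < gamma.

(** The control is unrestricted, as in [A_Lip], so compactness is available only after a bound [M]
    on it is added. *)
Definition tube : set (R * 'rV[R]_n * 'rV[R]_m) :=
  [set z | z.1.1 \in `[t0, t1] /\ `|z.1.2 - xs z.1.1| < gamma].

(** An arbitrary filter and an arbitrary limit [v] of the control cover at once the points of
    continuity and both one-sided limits at a jump. *)
Lemma tube_cvg (V : topologicalType) (h : R * 'rV[R]_n * 'rV[R]_m -> V)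
    (F : set_system R) {FF : Filter F} (t : R)
    (x : R -> 'rV[R]_n) (u : R -> 'rV[R]_m) y v :
  {within tube, continuous h} ->
  F --> within `[t0, t1] (nbhs t) -> tube (t, y, v) ->
  x @ F --> y -> u @ F --> v ->
  h (r, x r, u r) @[r --> F] --> h (t, y, v).
Proof.
move=> /subspace_continuousP ch Ft tyv xy uv.
have FI : \forall r \near F, r \in `[t0, t1] by apply: Ft; exact: withinT.
have tI : t \in `[t0, t1] by case: tyv.
have Fid : r @[r --> F] --> t.
  by move=> A nA; apply: Ft; exact: cvg_within.
have Fxs : xs @ F --> xs t.
  by move=> A nA; apply: Ft; have /subspace_continuousP/(_ t tI _ nA) := cxs.
have Ftube : \forall r \near F, tube (r, x r, u r).
  have : `|x r - xs r| @[r --> F] --> `|y - xs t|.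
    by apply: cvg_norm; exact: cvgB.
  move=> /cvgr_lt/(_ gamma); case: tyv => _ /= yg /(_ yg).
  by apply: filterS2 FI => r rI rg; split.
have H3 : (r, x r, u r) @[r --> F] --> (t, y, v) by exact: cvg_triple.
exact: cvg_comp (cvg_to_within Ftube H3) (ch _ tyv).
Qed.

Let Kset (M rho : R) : set (R * 'rV[R]_n * 'rV[R]_m) :=
  (`[t0, t1]%classic `*` [set z | `|z| <= rho]) `*` [set u | `|u| <= M].

Let compact_K M rho : compact (Kset M rho).
Proof.
apply: compact_setX; last exact: compact_norm_le.
by apply: compact_setX; [exact: segment_compact|exact: compact_norm_le].
Qed.

(** Translation by [xs] straightens the tube: for [rho < gamma] it maps the compact product
    [Kset M rho] into [tube]. *)
Let shift (z : R * 'rV[R]_n * 'rV[R]_m) := (z.1.1, xs z.1.1 + z.1.2, z.2).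

Let within_shift (V : topologicalType) (h : R * 'rV[R]_n * 'rV[R]_m -> V) M rho
  : rho < gamma ->
  {within tube, continuous h} -> {within Kset M rho, continuous (h \o shift)}.
Proof.
move=> rg /subspace_continuousP ch.
have tK z : Kset M rho z -> tube (shift z).
  move=> [[/= zI zr] _]; split => //=.
  by rewrite [_ + z.1.2]addrC addrK (le_lt_trans zr).
apply/subspace_continuousP => z Kz; have zt := tK z Kz.
set F := within _ _.
have FK : \forall r \near F, Kset M rho r by exact: withinT.
have Fz : r @[r --> F] --> z by exact: cvg_within.
have F1 : r.1 @[r --> F] --> z.1 by move=> A nA; exact: (Fz _ (cvg_fst nA)).
have F2 : r.2 @[r --> F] --> z.2 by move=> A nA; exact: (Fz _ (cvg_snd nA)).
have F11 : r.1.1 @[r --> F] --> z.1.1 by move=> A nA;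
  exact: (F1 _ (cvg_fst nA)).
have F12 : r.1.2 @[r --> F] --> z.1.2 by move=> A nA;
  exact: (F1 _ (cvg_snd nA)).
have FI : r.1.1 @[r --> F] --> within `[t0, t1] (nbhs z.1.1).
  by apply: cvg_to_within F11; apply: filterS FK => r [[]].
have Fxs : xs r.1.1 @[r --> F] --> xs z.1.1.
  apply: (cvg_comp _ _ FI).
  by have /subspace_continuousP := cxs; apply; case: Kz => [[]].
have Fs : shift r @[r --> F] --> within tube (nbhs (shift z)).
  apply: cvg_to_within; first by apply: filterS FK => r /tK.
  by apply: cvg_triple => //; exact: cvgD.
exact: cvg_comp Fs (ch _ zt).
Qed.

Lemma tube_bounded (V : normedModType R)
    (h : R * 'rV[R]_n * 'rV[R]_m -> V) (M rho : R) :
  rho < gamma -> {within tube, continuous h} ->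
  exists2 B : R, 0 < B & forall t y u, t \in `[t0, t1] -> `|y - xs t| <= rho ->
    `|u| <= M -> `|h (t, y, u)| <= B.
Proof.
move=> rg ch.
have := continuous_compact (within_shift rg ch) (@compact_K M rho).
move=> /compact_bounded[B [_ HB]].
exists (`|B| + 1); first by rewrite ltr_wpDl.
move=> t y u tI yr uM; apply: HB;
  first by rewrite (le_lt_trans (ler_norm B))// ltrDl.
exists (t, y - xs t, u); last by rewrite /shift/= subrKC.
by split.
Qed.

(** The displacement [z = y - xs t] is the parameter tending to 0, and [(t, u)] runs over a compact
    set. Near each [(t, 0, u)] both values are within [eta / 2] of the value at that point, and the
    near-covering form of compactness yields one neighbourhood of [z = 0] for all [(t, u)]. *)
Lemma tube_uniformly_continuous (V : normedModType R)
    (h : R * 'rV[R]_n * 'rV[R]_m -> V) (M eta : R) :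
  0 < eta -> {within tube, continuous h} ->
  exists2 delta : R, 0 < delta & forall t y u, t \in `[t0, t1] ->
    `|y - xs t| < delta -> `|u| <= M ->
    `|h (t, y, u) - h (t, xs t, u)| <= eta.
Proof.
move=> eta0 ch.
have g2 : gamma / 2 < gamma by rewrite ltr_pdivrMr// ltr_pMr// ltr1n.
have /subspace_continuousP cs := within_shift (M := M) g2 ch.
pose K : set (R * 'rV[R]_m) := `[t0, t1]%classic `*` [set u | `|u| <= M].
have cK : compact K.
  by apply: compact_setX; [exact: segment_compact|exact: compact_norm_le].
pose P (z : 'rV[R]_n) (tu : R * 'rV[R]_m) := `|z| <= gamma / 2 ->
  `|h (shift (tu.1, z, tu.2)) - h (shift (tu.1, 0, tu.2))| <= eta.
have : nbhs (0 : 'rV[R]_n) [set z | K `<=` P z].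
  have ncK : near_covering_within K.
    by apply/near_covering_withinP/compact_near_coveringP.
  apply: (ncK _ (nbhs (0 : 'rV[R]_n)) P _).
  move=> [t u] [/= tI uM].
  have Kt : Kset M (gamma / 2) (t, 0, u) by do 2!split => //=;
    rewrite normr0 divr_ge0// ltW.
  have e2 : 0 < eta / 2 by rewrite divr_gt0.
  have /cvgrPdist_le/(_ _ e2) := cs _ Kt.
  rewrite /= near_withinE => -[[/= A1 A2] [[[/= B1 B2] [n1 n2] nB] nA2] nA].
  exists (B1 `*` A2, B2); first by split => //; exists (B1, A2).
  move=> [[t' u'] z] [[/= B1t A2u] B2z] [/= t'I u'M] zg.
  have h1 := nA (t', z, u') (conj (nB (t', z) (conj B1t B2z)) A2u).
  have B20 : B2 0 by exact: nbhs_singleton.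
  have h2 := nA (t', 0, u') (conj (nB (t', 0) (conj B1t B20)) A2u).
  have {}h1 := h1 (conj (conj t'I zg) u'M).
  have {}h2 : `|(h \o shift) (t, 0, u) - (h \o shift) (t', 0, u')| <= eta / 2.
    by apply: h2; do 2!split => //=; rewrite normr0 divr_ge0// ltW.
  move: h1 h2; rewrite /comp/= => h1 h2.
  rewrite (le_trans (ler_distD (h (shift (t, 0, u))) _ _))//.
  by rewrite (distrC _ (h (shift (t, 0, u)))); lra.
move=> /nbhs_ballP[e /= e0 He].
exists (Num.min e (gamma / 2)).
  by rewrite lt_min e0 divr_gt0.
move=> t y u tI; rewrite lt_min => /andP[ye yg] uM.
have := He (y - xs t) _ (t, u) (conj tI uM) (ltW yg).
rewrite /shift/= addr0 subrKC; apply.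
by rewrite -ball_normE/= sub0r normrN.
Qed.

Section C1.
Variable g : R -> 'rV[R]_n -> 'rV[R]_m -> R.
Hypothesis Hg : C0_C1x_on tube g.

Let segment_in (t : R) (x y : 'rV[R]_n) (h rho : R) : `|x - xs t| <= rho ->
  `|y - xs t| <= rho -> 0 <= h <= 1 -> `|x + h *: (y - x) - xs t| <= rho.
Proof.
move=> xr yr /andP[h0 h1].
have -> : x + h *: (y - x) - xs t = (1 - h) *: (x - xs t) + h *: (y - xs t).
  by apply/rowP => i; rewrite !mxE; ring.
rewrite (le_trans (ler_normD _ _))// !normrZ !ger0_norm ?subr_ge0//.
have : (1 - h) * `|x - xs t| <= (1 - h) * rho by rewrite ler_wpM2l ?subr_ge0.
have : h * `|y - xs t| <= h * rho by rewrite ler_wpM2l.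
lra.
Qed.

Lemma tube_mean_value t x y u rho : rho < gamma -> t \in `[t0, t1] ->
  `|x - xs t| <= rho -> `|y - xs t| <= rho ->
  exists z, [/\ `|z - xs t| <= rho, `|z - x| <= `|y - x| &
    g t y u - g t x u = \sum_i grad (fun x => g t x u) z 0 i * (y - x) 0 i].
Proof.
move=> rg tI xr yr; have [_ dg _] := Hg.
have [|h h01 ->] := @mean_value_rV R n (fun x => g t x u) x y.
  move=> h h01; apply: dg; split => //=.
  by rewrite (le_lt_trans _ rg)// segment_in.
exists (x + h *: (y - x)); split => //; first exact: segment_in.
by rewrite addrAC subrr add0r normrZ; case/andP: h01 => h0 h1;
  rewrite ger0_norm// ler_piMl.
Qed.

Lemma tube_grad_continuous :
  {within tube, continuous (fun z => grad (fun y => g z.1.1 y z.2) z.1.2)}.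
Proof.
have [_ _ cD] := Hg; apply/subspace_continuousP => z tz; apply/cvg_rVP => i.
have -> : (fun z => grad (fun y => g z.1.1 y z.2) z.1.2 0 i) =
    (fun z => 'D_(delta_mx 0 i) (fun y => g z.1.1 y z.2) z.1.2).
  by apply/funext => y; rewrite mxE.
by rewrite mxE; have /subspace_continuousP/(_ z tz) := cD i.
Qed.

Lemma tube_lipschitz (M rho : R) : rho < gamma ->
  exists2 L : R, 0 < L & forall t x y u, t \in `[t0, t1] ->
    `|x - xs t| <= rho -> `|y - xs t| <= rho -> `|u| <= M ->
    `|g t x u - g t y u| <= L * `|x - y|.
Proof.
move=> rg; have [B B0 HB] := tube_bounded M rg tube_grad_continuous.
exists (n%:R * B + 1); first by rewrite ltr_wpDl// mulr_ge0// ltW.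
move=> t x y u tI xr yr uM.
have [z [zr _ ->]] := tube_mean_value u rg tI yr xr.
apply: le_trans (sum_mul_le _ _) _.
rewrite ler_wpM2r// -[leLHS]addr0 lerD// ler_wpM2l//.
exact: (HB t z u tI zr uM).
Qed.

(** By the mean value theorem the remainder pairs [x - xs t] with an increment of the gradient,
    which is uniformly small. A single [delta] for all [t] and all bounded controls is what allows
    the error to be integrated. *)
Lemma tube_uniformly_differentiable (M eta : R) : 0 < eta ->
  exists2 delta : R, 0 < delta & forall t x u, t \in `[t0, t1] ->
    `|x - xs t| < delta -> `|u| <= M ->
    `|g t x u - g t (xs t) u
      - \sum_i grad (fun x => g t x u) (xs t) 0 i * (x - xs t) 0 i|
    <= eta * `|x - xs t|.
Proof.
move=> eta0.
have n0 : 0 < (n%:R + 1 : R) by rewrite ltr_wpDl.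
have eta1 : 0 < eta / (n%:R + 1) by rewrite divr_gt0.
have [d d0 Hd] := tube_uniformly_continuous M eta1 tube_grad_continuous.
exists (Num.min d (gamma / 2)); first by rewrite lt_min d0 divr_gt0.
move=> t x u tI; rewrite lt_min => /andP[xd xg] uM.
have g2 : gamma / 2 < gamma by rewrite ltr_pdivrMr// ltr_pMr// ltr1n.
have r0 : `|xs t - xs t| <= gamma / 2 by rewrite subrr normr0 divr_ge0// ltW.
have [z [zr zx ->]] := tube_mean_value u g2 tI r0 (ltW xg).
rewrite -sumrB.
under eq_bigr do rewrite -mulrBl -rVBE.
apply: le_trans (sum_mul_le _ _) _; rewrite ler_wpM2r//.
apply: (@le_trans _ _ (n%:R * (eta / (n%:R + 1)))).
  rewrite ler_wpM2l//; apply: (Hd t z u) => //.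
  exact: le_lt_trans xd.
by rewrite mulrCA ler_piMr ?(ltW eta0)// ler_pdivrMr// mul1r lerDl.
Qed.

End C1.
End tube.

(** * Piecewise continuous functions *)

Section piecewise_continuity.
Context {R : realType}.
Implicit Types (a b t : R) (s : seq R).

(* At [V := R] this is [piecewise_continuous_off]. *)
Definition pc_off (V : normedModType R) a b s (g : R -> V) : Prop :=
  [/\ forall t, t \in s -> a < t < b,
      forall t, t \in `[a, b] -> t \notin s ->
        g @ within [set` `[a, b]] (nbhs t) --> g t
    & forall t, t \in s -> cvg (g @ t^'-) /\ g @ t^'+ --> g t].

Lemma nbhs_oo_cc a b t : a < t < b -> \forall r \near t, r \in `[a, b].
Proof.
move=> tab; have : t \in `]a, b[ by rewrite in_itv.
by move=> /near_in_itvoo; apply: filterS => r;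
  rewrite !in_itv/= => /andP[/ltW-> /ltW->].
Qed.

Lemma at_left_within_cc a b t : a < t < b -> t^'- --> within `[a, b] (nbhs t).
Proof.
move=> tab A; rewrite /= /within/= => nA.
rewrite /at_left; apply: filterS2 (nbhs_oo_cc tab) nA => r rab h rt; exact: h.
Qed.

Lemma at_right_within_cc a b t : a < t < b -> t^'+ --> within `[a, b] (nbhs t).
Proof.
move=> tab A; rewrite /= /within/= => nA.
rewrite /at_right; apply: filterS2 (nbhs_oo_cc tab) nA => r rab h rt; exact: h.
Qed.

Lemma near_left_right (P : R -> Prop) t : (\forall r \near t^'-, P r) ->
  P t -> (\forall r \near t^'+, P r) -> \forall r \near t, P r.
Proof.
rewrite /at_left /at_right !near_withinE => Pl Pt.
apply: filterS2 Pl => r Pl Pr.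
by have [rt|tr|->] := ltgtP r t; [exact: Pl|exact: Pr|].
Qed.

Lemma pc_off_continuous (V : normedModType R) a b s (g : R -> V) t :
  pc_off a b s g -> a < t < b -> t \notin s -> {for t, continuous g}.
Proof.
move=> [_ cg _] tab ts.
have tI : t \in `[a, b] by rewrite in_itv/=; case/andP: tab => /ltW-> /ltW->.
move=> A nA; have := cg t tI ts A nA; rewrite /= /within/=.
by apply: filterS2 (nbhs_oo_cc tab) => r rab; exact.
Qed.

Lemma pc_off_sub (V : normedModType R) a b s s' (g : R -> V) :
  {subset s <= s'} -> (forall t, t \in s' -> a < t < b) ->
  pc_off a b s g -> pc_off a b s' g.
Proof.
move=> ss s'ab [sab cg jg]; split=> // [t tI ts'|t ts'].
  by apply: cg => //; apply: contra ts'; exact: ss.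
have [/jg//|ts] := boolP (t \in s).
have tab := s'ab t ts'.
have tI : t \in `[a, b] by rewrite in_itv/=; case/andP: tab => /ltW-> /ltW->.
have gt := cg t tI ts; split.
  apply/cvg_ex; exists (g t).
  by move=> A nA; apply: (at_left_within_cc tab); exact: gt.
by move=> A nA; apply: (at_right_within_cc tab); exact: gt.
Qed.

(** Each point has a neighbourhood with a bound, at a jump the larger of those given by the two
    sides. Compactness makes it global, with the bound, tending to infinity, as the parameter of the
    covering. *)
Lemma pc_off_bounded (V : normedModType R) a b s (g : R -> V) :
  pc_off a b s g -> exists2 M : R, 0 < M & forall t, t \in `[a, b] -> `|g t| <=
    M.
Proof.
move=> [sab cg jg].
have loc t : t \in `[a, b] ->
    exists M : R, \forall r \near t, r \in `[a, b] -> `|g r| <= M.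
  move=> tI; have [ts|ts] := boolP (t \in s); last first.
    exists (`|g t| + 1); have /cvgrPdist_le/(_ _ ltr01) := cg t tI ts.
    rewrite near_withinE; apply: filterS => r h rI; have {}h := h rI.
    rewrite -[g r](subrKC (g t)) (le_trans (ler_normD _ _))// lerD2l.
    by rewrite distrC.
  have [/cvg_ex[l gl] gr] := jg t ts.
  exists (Num.max (`|l| + 1) (`|g t| + 1)); apply: near_left_right.
  - move/cvgrPdist_le : gl => /(_ _ ltr01); apply: filterS => r h _.
    rewrite le_max -[g r](subrKC l) (le_trans (ler_normD _ _))// lerD2l.
    by rewrite distrC.
  - by move=> _; rewrite le_max lerDl ler01 orbT.
  - move/cvgrPdist_le : gr => /(_ _ ltr01); apply: filterS => r h _.
    rewrite le_max orbC -[g r](subrKC (g t)) (le_trans (ler_normD _ _))//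
      lerD2l.
    by rewrite distrC.
pose P (M : R) (t : R) := `|g t| <= M.
have : \forall M \near +oo, `[a, b]%classic `<=` P M.
  have ncI : near_covering_within `[a, b]%classic.
    apply/near_covering_withinP/compact_near_coveringP; exact: segment_compact.
  apply: (ncI _ +oo P _) => t tI; have [M MP] := loc t tI.
  exists ([set r | r \in `[a, b] -> `|g r| <= M], [set N | M <= N]).
    by split => //=; exact: nbhs_pinfty_ge (num_real M).
  by move=> [r N] [/= h MN] rI; rewrite /P (le_trans (h rI)).
move=> /pinfty_ex_gt0[M M0 MP]; exists M => // t tI; exact: MP.
Qed.

Lemma pc_off_bounded_continuous_off a b s (g : R -> R) :
  pc_off a b s g -> bounded_continuous_off a b s g.
Proof.
move=> pg; split; first by have [M _ MP] := pc_off_bounded pg; exists M.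
by move=> t; exact: pc_off_continuous.
Qed.

Lemma PC_pc_off k a b (u : R -> 'rV[R]_k) : PC a b u -> exists s, pc_off a b s
  u.
Proof.
move=> /choice[s sP]; exists (flatten [seq s i | i <- enum 'I_k]).
have sub i : {subset s i <= flatten [seq s i | i <- enum 'I_k]}.
  by move=> t ti; apply/flatten_mapP; exists i; rewrite ?mem_enum.
have sab t : t \in flatten [seq s i | i <- enum 'I_k] -> a < t < b.
  by move=> /flatten_mapP[i _ ti]; case: (sP i) => + _ _; exact.
have {}sP i : pc_off a b (flatten [seq s i | i <- enum 'I_k]) (fun t =>
  u t 0 i).
  exact: pc_off_sub (sub i) sab (sP i).
split=> // [t tI ts|t ts].
  by apply/cvg_rVP => i; have [_ + _] := sP i; exact.
split.
  have /choice[l lP] : forall i, exists l : R, u t 0 i @[t --> t^'-] --> l.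
    by move=> i; apply/cvg_ex; have [_ _ /(_ t ts)[]] := sP i.
  by apply/cvg_ex; exists (\row_i l i); apply/cvg_rVP => i; rewrite mxE.
by apply/cvg_rVP => i; have [_ _ /(_ t ts)[]] := sP i.
Qed.

Lemma pc_off_coord k a b s (u : R -> 'rV[R]_k) i :
  pc_off a b s u -> pc_off a b s (fun t => u t 0 i).
Proof.
move=> [sab cu ju]; split=> // [t tI ts|t ts].
  by have /cvg_rVP := cu t tI ts; exact.
have [/cvg_ex[l /cvg_rVP ul] /cvg_rVP ur] := ju t ts; split => //.
by apply/cvg_ex; exists (l 0 i).
Qed.

Lemma pc_off_PC k a b s (u : R -> 'rV[R]_k) : pc_off a b s u -> PC a b u.
Proof. by move=> pu i; exists s; exact: pc_off_coord. Qed.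

(** Closed on the left and open on the right, so that the modified control stays right-continuous at
    [tau] and [sigma]. *)
Definition needle (V : Type) (tau sigma : R) (v : V) (g : R -> V) (t : R) : V :=
  if tau <= t < sigma then v else g t.

Lemma pc_off_needle (V : normedModType R) a b s tau sigma (v : V) (g : R -> V) :
  a < tau -> tau < sigma -> sigma < b -> pc_off a b s g ->
  pc_off a b (tau :: sigma :: s) (needle tau sigma v g).
Proof.
move=> atau ts sb pg.
have sab t : t \in tau :: sigma :: s -> a < t < b.
  rewrite !inE => /or3P[/eqP->|/eqP->|].
  - by rewrite atau (lt_trans ts).
  - by rewrite sb (lt_trans atau).
  - by case: pg => + _ _; exact.
have {pg} [_ cg jg] : pc_off a b (tau :: sigma :: s) g.
  by apply: pc_off_sub sab pg => t; rewrite !inE => ->; rewrite !orbT.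
(* All cases below reduce to two: a filter eventually outside the needle sees [g], and one
   eventually inside sees the constant [v]. *)
have Eg (F : set_system R) (FF : Filter F) l :
    (\forall r \near F, ~~ (tau <= r < sigma)) -> g @ F --> l ->
    needle tau sigma v g @ F --> l.
  move=> FN gl A nA; apply: filterS2 FN (gl A nA) => r rN.
  by rewrite /= /needle (negbTE rN).
have Ev (F : set_system R) (FF : Filter F) :
    (\forall r \near F, tau <= r < sigma) -> needle tau sigma v g @ F --> v.
  move=> FN A nA; apply: filterS FN => r rN /=.
  by rewrite /needle rN; exact: nbhs_singleton.
have cvg_to (F : set_system R) (l : V) : needle tau sigma v g @ F --> l ->
  cvg (needle tau sigma v g @ F) by move=> h; apply/cvg_ex; exists l.
split=> // [t tI|t tS].
  rewrite !inE !negb_or => /and3P[ttau tsigma tns].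
  have cgt : g @ within `[a, b] (nbhs t) --> g t.
    by apply: cg => //; rewrite !inE !negb_or ttau tsigma.
  have [ltt|gtt] : t < tau \/ tau < t.
    by apply/orP; rewrite -neq_lt.
  - rewrite {2}/needle leNgt ltt/=; apply: Eg cgt.
    apply: cvg_within; near=> r; rewrite negb_and -ltNge; apply/orP; left.
    by near: r; exact: lt_nbhsl.
  - have [lts|gts] : t < sigma \/ sigma < t.
      by apply/orP; rewrite -neq_lt.
    + rewrite {2}/needle lts (ltW gtt)/=; apply: Ev.
      apply: cvg_within; near=> r; apply/andP; split.
        by apply: ltW; near: r; exact: lt_nbhsr.
      by near: r; exact: lt_nbhsl.
    + rewrite {2}/needle ltNge (ltW gts) andbF; apply: Eg cgt.
      apply: cvg_within; near=> r; rewrite negb_and -!leNgt; apply/orP; right.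
      by apply: ltW; near: r; exact: lt_nbhsr.
have [gl gr] := jg t tS; have /cvg_ex[l {}gl] := gl.
have [ltt|gtt|->] := ltgtP t tau.
- split.
    apply: (cvg_to _ l); apply: Eg gl; near=> r; rewrite negb_and -ltNge;
      apply/orP; left.
    by rewrite (@lt_trans _ _ t).
  rewrite {2}/needle leNgt ltt/=; apply: Eg gr; near=> r.
  by rewrite negb_and -ltNge; apply/orP; left; near: r; exact: nbhs_right_lt.
- have [lts|gts|->] := ltgtP t sigma.
  + split.
      apply: (cvg_to _ v); apply: Ev; near=> r; apply/andP; split.
        by apply: ltW; near: r; exact: nbhs_left_gt.
      by rewrite (@lt_trans _ _ t).
    rewrite {2}/needle lts (ltW gtt)/=; apply: Ev; near=> r; apply/andP; split.
      by rewrite (le_trans (ltW gtt))// ltW.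
    by near: r; exact: nbhs_right_lt.
  + split.
      apply: (cvg_to _ l); apply: Eg gl; near=> r; rewrite negb_and -!leNgt;
        apply/orP; right.
      by apply: ltW; near: r; exact: nbhs_left_gt.
    rewrite {2}/needle ltNge (ltW gts) andbF; apply: Eg gr; near=> r.
    by rewrite negb_and -!leNgt (le_trans (ltW gts)) ?orbT// ltW.
  + split.
      apply: (cvg_to _ v); apply: Ev; near=> r; apply/andP; split => //.
      by apply: ltW; near: r; exact: nbhs_left_gt.
    rewrite {2}/needle ltxx andbF; apply: Eg; last first.
      by have [] := jg sigma; rewrite ?inE ?eqxx ?orbT.
    near=> r.
    by rewrite negb_and -!leNgt; apply/orP; right; exact: ltW.
- have [gl' gr'] : cvg (g @ tau^'-) /\ g @ tau^'+ --> g tau.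
    by apply: jg; rewrite inE eqxx.
  have /cvg_ex[l' {}gl'] := gl'.
  split.
    apply: (cvg_to _ l'); apply: Eg gl'; near=> r; rewrite negb_and -ltNge;
      apply/orP; left.
    by [].
  rewrite {2}/needle lexx ts/=; apply: Ev; near=> r; apply/andP; split.
    by apply: ltW.
  by near: r; exact: nbhs_right_lt.
Unshelve. all: by end_near. Qed.

End piecewise_continuity.

(** * The adjoint equation *)

Lemma eq_continuous_within (S T : topologicalType) (A : set S) (f g : S -> T) :
  (forall z, A z -> f z = g z) -> {within A, continuous g} ->
  {within A, continuous f}.
Proof.
by move=> fg; apply: subspace_eq_continuous => z; rewrite inE => /fg/esym.
Qed.

Lemma C0_C1x_on_coord (R : realType) (n m k : nat)
    (A : set (R * 'rV[R]_n * 'rV[R]_m))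
    (g : R -> 'rV[R]_n -> 'rV[R]_m -> 'rV[R]_k) (j : 'I_k) :
  C0_C1x_on A g -> C0_C1x_on A (fun t y u => g t y u 0 j).
Proof.
move=> [cg dg cD]; split.
- apply/subspace_continuousP => z Az.
  by have /subspace_continuousP/(_ z Az)/cvg_rVP := cg; exact.
- move=> t y u Atyu.
  by apply: (@differentiable_comp _ _ _ _ (fun y =>
    g t y u) (fun v : 'rV_k => v 0 j));
     [exact: dg|exact: differentiable_coord].
- move=> i; apply: (@eq_continuous_within _ _ _ _
      (fun z => 'D_(delta_mx 0 i) (fun x => g z.1.1 x z.2) z.1.2 0 j)).
    move=> y Ay; rewrite derive_mx ?mxE//; apply: diff_derivable; apply: dg.
    by case: y Ay => [[]].
  apply/subspace_continuousP => z Az.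
  by have /subspace_continuousP/(_ z Az)/cvg_rVP/(_ j) := cD i.
Qed.

Section pontryagin.
Context {R : realType} {n m : nat} (t0 t1 : R) (xs : R -> 'rV[R]_n) (gamma : R).
Hypothesis cxs : {within `[t0, t1], continuous xs}.
Hypothesis gamma0 : 0 < gamma.
Variables (f : R -> 'rV[R]_n -> 'rV[R]_m -> R)
  (phi : R -> 'rV[R]_n -> 'rV[R]_m -> 'rV[R]_n).
Notation T := (@tube R n m t0 t1 xs gamma).
Hypotheses (Hf : C0_C1x_on T f) (Hphi : C0_C1x_on T phi).

Lemma tube_center t u : t \in `[t0, t1] -> T (t, xs t, u).
Proof. by move=> tI; split => //=; rewrite subrr normr0. Qed.

(** At a jump the left limit of a control with values in some set may leave that set. The composite
    still has a left limit, because the tube admits every control value. *)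
Lemma pc_off_tube (V : normedModType R) (h : R * 'rV[R]_n * 'rV[R]_m -> V)
    s (x : R -> 'rV[R]_n) (u : R -> 'rV[R]_m) :
  {within T, continuous h} -> {within `[t0, t1], continuous x} ->
  (forall t, t \in `[t0, t1] -> `|x t - xs t| < gamma) ->
  pc_off t0 t1 s u -> pc_off t0 t1 s (fun t => h (t, x t, u t)).
Proof.
move=> ch /subspace_continuousP cx xg [sI cu ju].
split=> // [t tI ts|t ts].
  apply: tube_cvg => //; first by split => //; exact: xg.
    exact: cx.
  exact: cu.
have tI : t \in `[t0, t1].
  by rewrite in_itv/=; case/andP: (sI t ts) => /ltW-> /ltW->.
have lI := at_left_within_cc (sI t ts); have rI := at_right_within_cc (sI t ts).
have [/cvg_ex[l ul] ur] := ju t ts; split.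
  apply/cvg_ex; exists (h (t, x t, l)); apply: tube_cvg => //.
    by split => //; exact: xg.
  by move=> A nA; apply: lI; exact: cx.
apply: tube_cvg => //; first by split => //; exact: xg.
by move=> A nA; apply: rI; exact: cx.
Qed.

Lemma is_derive_pontryagin t x u p v : T (t, x, u) ->
  is_derive x v (fun y => pontryagin f phi t y u p)
    (\sum_j p 0 j * ('D_v (fun y => phi t y u) x) 0 j - 'D_v (fun y =>
      f t y u) x).
Proof.
move=> Tx; have [_ /(_ _ _ _ Tx) df _] := Hf;
  have [_ /(_ _ _ _ Tx) dp _] := Hphi.
have dj j : is_derive x v (fun y => phi t y u 0 j) ('D_v (fun y =>
  phi t y u) x 0 j).
  have d : derivable (fun y => phi t y u) x v by exact: diff_derivable.
  have dm := (derivable_mxP _ _ _).1 d.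
  have -> : 'D_v (fun y => phi t y u) x 0 j = 'D_v (fun y => phi t y u 0 j) x.
    by rewrite derive_mx// mxE.
  exact/derivableP/dm.
have djp j : is_derive x v (p 0 j \*: (fun y =>
  phi t y u 0 j)) (p 0 j * 'D_v (fun y => phi t y u) x 0 j).
  exact: is_deriveZ.
have dfx : is_derive x v (fun y => f t y u) ('D_v (fun y => f t y u) x).
  exact/derivableP/diff_derivable.
have := is_deriveB (is_derive_sum djp) dfx.
rewrite (_ : _ - _ = (fun y => pontryagin f phi t y u p))//.
by apply/funext => y; rewrite /pontryagin !fctE fct_sumE.
Qed.

(** With a continuous [p] inserted, the Pontryagin function is of the same class as [f], so the tube
    estimates apply to it as a whole. *)
Lemma pontryagin_C0_C1x (p : R -> 'rV[R]_n) :
  {within `[t0, t1], continuous p} ->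
  C0_C1x_on T (fun t y u => pontryagin f phi t y u (p t)).
Proof.
move=> /subspace_continuousP cp.
have [cf df cDf] := Hf; have [cph dph cDph] := Hphi.
have cp' z j : T z -> p y.1.1 0 j @[y --> within T (nbhs z)] --> p z.1.1 0 j.
  move=> Tz; have zI : z.1.1 \in `[t0, t1] by case: Tz.
  set F := within _ _.
  have FT : \forall r \near F, T r by exact: withinT.
  have Fz : r @[r --> F] --> z by exact: cvg_within.
  have F1 : r.1 @[r --> F] --> z.1 by move=> A nA; exact: (Fz _ (cvg_fst nA)).
  have F11 : r.1.1 @[r --> F] --> z.1.1 by move=> A nA;
    exact: (F1 _ (cvg_fst nA)).
  have FI : r.1.1 @[r --> F] --> within `[t0, t1] (nbhs z.1.1).
    by apply: cvg_to_within F11; apply: filterS FT => r [].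
  have /cvg_rVP/(_ j) := cp _ zI.
  by move=> pz; apply: (cvg_comp _ _ FI pz).
split.
- apply/subspace_continuousP => z Tz; apply: cvgB.
    apply: cvg_big => [|j _]; first exact: add_continuous.
    apply: cvgM; first exact: cp'.
    by have /subspace_continuousP/(_ z Tz)/cvg_rVP H := cph; exact: H.
  by have /subspace_continuousP := cf; exact.
- move=> t y u Ttyu.
  have dphj j := C0_C1x_on_coord j Hphi.
  rewrite /pontryagin.
  apply: (@differentiableB _ _ _ (fun y => \sum_i p t 0 i * phi t y u 0 i));
    last exact: df.
  have -> : (fun y => \sum_i p t 0 i * phi t y u 0 i) =
      \sum_i (p t 0 i \*: (fun y => phi t y u 0 i)).
    by apply/funext => x; rewrite fct_sumE.
  apply: differentiable_sum => j; apply: differentiableZ.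
  by have [_ + _] := dphj j; exact.
- move=> i; apply: (@eq_continuous_within _ _ _ _ (fun y =>
      \sum_j p y.1.1 0 j * ('D_(delta_mx 0 i) (fun x =>
        phi y.1.1 x y.2) y.1.2) 0 j
      - 'D_(delta_mx 0 i) (fun x => f y.1.1 x y.2) y.1.2)).
    move=> y Ty; have Ty' : T (y.1.1, y.1.2, y.2) by case: y Ty => [[]].
    by have [_ ->] := is_derive_pontryagin (p y.1.1) (delta_mx 0 i) Ty'.
  apply/subspace_continuousP => z Tz; apply: cvgB.
    apply: cvg_big => [|j _]; first exact: add_continuous.
    apply: cvgM; first exact: cp'.
    by have /subspace_continuousP/(_ z Tz)/cvg_rVP H := cDph i; exact: H.
  by have /subspace_continuousP := cDf i; exact.
Qed.

(** The right-hand side is affine in [q], with bounded coefficients along [xs], hence globally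
    Lipschitz: [picard] runs backwards from [t1] without clamping. The iteration starts at 0, and
    [K] bounds the right-hand side there. *)
Lemma adjoint_exists (t01 : t0 <= t1) s (us : R -> 'rV[R]_m) (p1 : 'rV[R]_n) :
  pc_off t0 t1 s us ->
  let pdot p t := - grad (fun x => pontryagin f phi t x (us t) (p t)) (xs t) in
  exists p : R -> 'rV[R]_n, [/\ {within `[t0, t1], continuous p}, p t1 = p1,
    pc_off t0 t1 s (pdot p) &
    forall i, primitive_off t0 t1 s (fun t => p t 0 i) (fun t => pdot p t 0 i)].
Proof.
move=> pus pdot.
pose F t q := - grad (fun x => pontryagin f phi t x (us t) q) (xs t).
have pcF p : {within `[t0, t1], continuous p} -> pc_off t0 t1 s (fun t =>
  F t (p t)).
  move=> cp; have Hp := pontryagin_C0_C1x cp.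
  have := pc_off_tube (tube_grad_continuous Hp) cxs _ pus.
  move=> /(_ (fun t _ => _))/= pg.
  have {}pg : pc_off t0 t1 s (fun t => grad (fun x =>
    pontryagin f phi t x (us t) (p t)) (xs t)).
    by apply: pg => t; rewrite subrr normr0.
  move: pg => [sI c j]; split => // [t tI ts|t ts].
    by apply: cvgN; exact: c.
  have [/cvg_ex[l cl] cr] := j t ts; split; last exact: cvgN.
  by apply/cvg_ex; exists (- l); exact: cvgN.
have [M M0 usM] := pc_off_bounded pus.
have [_ _ cDphi] := Hphi.
have g2 : gamma / 2 < gamma by rewrite ltr_pdivrMr// ltr_pMr// ltr1n.
have [B B0 HB] : exists2 B : R, 0 < B & forall i t, t \in `[t0, t1] ->
    `|'D_(delta_mx 0 i) (fun y => phi t y (us t)) (xs t)| <= B.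
  apply: fin_upper => [i|i B B' BB' HB t tI];
    last exact: le_trans (HB t tI) BB'.
  have [B B0 HB] := tube_bounded cxs M g2 (cDphi i).
  exists B => // t tI; apply: (HB t (xs t) (us t)) => //.
    by rewrite subrr normr0 divr_ge0// ltW.
  exact: usM.
have L0 : 0 < n%:R * B + 1 by rewrite ltr_wpDl// mulr_ge0// ltW.
have HL t : t \in `[t0, t1] -> forall q r, `|F t q - F t r| <= (n%:R * B + 1) *
  `|q - r|.
  move=> tI q r; apply: rV_norm_le => [|i]; first by rewrite mulr_ge0// ltW.
  have Tt := tube_center (us t) tI.
  rewrite rVBE /F /grad !mxE.
  have [_ ->] := is_derive_pontryagin q (delta_mx 0 i) Tt.
  have [_ ->] := is_derive_pontryagin r (delta_mx 0 i) Tt.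
  rewrite opprK addrC opprB addrA subrK -normrN opprB -sumrB.
  under eq_bigr do rewrite -mulrBl -rVBE.
  apply: le_trans (sum_mul_le _ _) _.
  rewrite mulrAC ler_wpM2r// -[leLHS]addr0 lerD// ler_wpM2l//.
  exact: HB.
have tt1 : t1 \in `[t0, t1] by rewrite in_itv/= t01 lexx.
have sgP t : t \in `[t0, t1] -> 0 <= -1 * (t - t1).
  by rewrite in_itv/= => /andP[_ ?]; rewrite mulN1r opprB subr_ge0.
have HF p : {within `[t0, t1], continuous p} ->
    forall i, bounded_continuous_off t0 t1 s (fun t => F t (p t) 0 i).
  by move=> cp i; apply: pc_off_bounded_continuous_off; apply: pc_off_coord;
    exact: pcF.
have c0 : {within `[t0, t1], continuous (cst 0 : R -> 'rV[R]_n)}.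
  by apply: continuous_subspaceT => t; exact: cst_continuous.
have [K K0 HK] := pc_off_bounded (pcF _ c0).
have N1 : -1 * -1 = 1 :> R by rewrite mulrNN mulr1.
have [|t i tI|p [cp pt1 dp _]] :=
  @picard R n t0 t1 s F _ t1 (-1) p1 L0 tt1 N1 sgP HF HL
    (cst 0) (`|p1| + K * (t1 - t0)) _ c0.
- by rewrite addr_ge0// mulr_ge0 ?(ltW K0)// subr_ge0.
- rewrite mxE subr0 (le_trans (ler_normD _ _))// lerD//;
  first exact: le_rV_norm.
  have pI := integral_from_primitive t01 (HF _ c0 i).
  have := primitive_off_norm_le tI tt1 pI (primitive_off_linear t0 t1 s K).
  move=> /(_ _)/le_trans; apply.
    move=> r rI rs; apply: le_trans (le_rV_norm _ _) _; apply: HK.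
    by rewrite in_itv/=; case/andP: rI => /ltW-> /ltW->.
  rewrite -mulrBr normrM (ger0_norm (ltW K0)) ler_wpM2l ?(ltW K0)//.
  by move: tI; rewrite in_itv/= => tI; rewrite ler_norml; lra.
exists p; split => //; exact: pcF.
Qed.

End pontryagin.

(** * Needle variations *)

Section needle_estimates.
Context {R : realType}.
Implicit Types (a b t : R) (s : seq R) (G g : R -> R).

(** [G] is compared with a linear function on each of the three pieces; [0 <= e] allows [e] to be
    charged on the needle too. The sign of [k] is free, since in the application [k] measures a
    decrease. *)
Lemma primitive_off_needle_le a b s G g tau sigma e k :
  a <= tau -> tau <= sigma -> sigma <= b -> 0 <= e -> primitive_off a b s G g ->
  (forall t, a < t < b -> t \notin s -> g t <= if tau <= t < sigma then k else
    e) ->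
  G b - G a <= e * (b - a) + k * (sigma - tau).
Proof.
move=> atau ts sb e0 pG gh.
have piece c d l : a <= c -> c <= d -> d <= b ->
    (forall t, c < t < d -> (if tau <= t < sigma then k else e) = l) ->
    G d - G c <= l * (d - c).
  move=> ac cd db hl; rewrite mulrBr.
  apply: (primitive_off_le cd (primitive_offW ac db pG)
    (primitive_off_linear c d s l)) => t tcd tns /=.
  rewrite -(hl t tcd); apply: gh => //.
  by case/andP: tcd => ct td; rewrite (le_lt_trans ac)// (lt_le_trans td).
have h1 : G tau - G a <= e * (tau - a).
  apply: piece => //; first exact: le_trans sb.
  by move=> t /andP[_ tt]; rewrite leNgt tt.
have h2 : G sigma - G tau <= k * (sigma - tau).
  by apply: piece => // t /andP[/ltW -> ->].
have h3 : G b - G sigma <= e * (b - sigma).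
  apply: piece => //; first exact: le_trans ts.
  by move=> t /andP[st _]; rewrite [t < sigma]ltNge (ltW st) andbF.
have h4 : e * (b - a) = e * (tau - a) + e * (sigma - tau) + e * (b - sigma) by
  ring.
have h5 : 0 <= e * (sigma - tau) by rewrite mulr_ge0// subr_ge0.
lra.
Qed.

Lemma primitive_off_needle_norm_le a b s G g tau sigma k t :
  a <= tau -> tau <= sigma -> t \in `[a, b] -> 0 <= k -> primitive_off a b s G
    g ->
  (forall t, a < t < b -> t \notin s -> `|g t| <= if tau <= t < sigma then k
    else 0) ->
  `|G t - G a| <= k * (sigma - tau).
Proof.
rewrite in_itv/= => atau ts /andP[at_ tb] k0 pG gk.
have {}pG := primitive_offW (lexx a) tb pG.
(* Only the part of the needle before [t] contributes, so both ends are cut off at [t], which does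
   not lengthen it. *)
have len : k * (Num.min sigma t - Num.min tau t) <= k * (sigma - tau).
  rewrite ler_wpM2l//.
  by have [h1|h1] := leP sigma t; have [h2|h2] := leP tau t; lra.
have atau' : a <= Num.min tau t by rewrite le_min atau.
have ts' : Num.min tau t <= Num.min sigma t by rewrite le_min !ge_min ts lexx
  orbT.
have st' : Num.min sigma t <= t by rewrite ge_min lexx orbT.
have cut r : a < r < t -> r \notin s ->
    `|g r| <= if Num.min tau t <= r < Num.min sigma t then k else 0.
  move=> /andP[ar rt] rs.
  have := gk r; rewrite ar (lt_le_trans rt tb) => /(_ isT rs).
  by rewrite ge_min (leNgt t r) rt orbF lt_min rt andbT.
rewrite ler_norml; apply/andP; split.
  rewrite lerNl opprB; apply: le_trans len.
  have := primitive_off_needle_le atau' ts' st' (lexx 0) (primitive_offN pG).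
  move=> /(_ k) h; rewrite -[leRHS]add0r -(mul0r (t - a)).
  apply: le_trans (h _) => [|r rab rs /=]; first by rewrite /= opprK addrC.
  by apply: le_trans (cut r rab rs); rewrite -normrN ler_norm.
apply: le_trans len.
have := primitive_off_needle_le atau' ts' st' (lexx 0) pG.
move=> /(_ k) h; rewrite -[leRHS]add0r -(mul0r (t - a)); apply: h => r rab rs.
by apply: le_trans (cut r rab rs); rewrite ler_norm.
Qed.

End needle_estimates.

Section clamp.
Context {R : realType} {n : nat} (rho : R).
Hypothesis rho0 : 0 <= rho.
Implicit Types z : 'rV[R]_n.

(** Balls of the maximum norm are cubes, so truncating each entry is a retraction onto the ball with
    Lipschitz constant 1, and the extended right-hand side keeps the constant of [phi]. *)
Definition clamp z : 'rV[R]_n := \row_i Num.max (- rho) (Num.min rho (z 0 i)).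

Lemma clamp_le z : `|clamp z| <= rho.
Proof.
apply: rV_norm_le => // i; rewrite mxE ler_norml le_max lexx/=.
by rewrite ge_max ge_min lexx/= andbT; move: rho0; lra.
Qed.

Lemma clamp_id z : `|z| <= rho -> clamp z = z.
Proof.
move=> zr; apply/rowP => i; rewrite mxE.
have := le_trans (le_rV_norm z i) zr; rewrite ler_norml => /andP[h1 h2].
by rewrite min_r// max_r.
Qed.

Lemma clamp_lipschitz z z' : `|clamp z - clamp z'| <= `|z - z'|.
Proof.
apply: rV_norm_le => // i; apply: le_trans (le_rV_norm (z - z') i).
rewrite !rVBE 2![clamp _ _ _]mxE /Order.max /Order.min.
move: rho0; set x := z 0 i; set y := z' 0 i => r0.
have Exy : `|x - y| = Num.max (x - y) (y - x) by rewrite -(opprB x y) maxrN.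
rewrite ler_norml Exy lerNl opprB !le_max.
by repeat case: ifPn; rewrite -?leNgt => *; apply/andP; split; apply/orP;
  case: (leP x y) => *; first [left; lra | right; lra].
Qed.

Lemma clamp_continuous : continuous clamp.
Proof.
move=> z; apply/(@cvgrPdist_le _ _ _ _ (nbhs_filter z)) => e e0.
apply/nbhs_ballP; exists e => //= y; rewrite -ball_normE/= => zy.
exact: le_trans (clamp_lipschitz _ _) (ltW zy).
Qed.

End clamp.

(** [C] is fixed before [tau] and [sigma], so the needle can shrink while [C] stays. This is
    possible because a single [M] bounds all the needle controls. *)
Lemma needle_trajectory (R : realType) (n m : nat) (t0 t1 : R)
    (xs : R -> 'rV[R]_n) (us : R -> 'rV[R]_m) (gamma : R) s
    (phi : R -> 'rV[R]_n -> 'rV[R]_m -> 'rV[R]_n) (v : 'rV[R]_m) :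
  t0 < t1 -> 0 < gamma -> {within `[t0, t1], continuous xs} ->
  C0_C1x_on (@tube R n m t0 t1 xs gamma) phi -> pc_off t0 t1 s us ->
  (forall i, primitive_off t0 t1 s (fun t => xs t 0 i)
               (fun t => phi t (xs t) (us t) 0 i)) ->
  exists2 C : R, 0 < C & forall tau sigma, t0 < tau -> tau < sigma -> sigma <
    t1 ->
    C * (sigma - tau) <= gamma / 2 ->
    exists x : R -> 'rV[R]_n, [/\ {within `[t0, t1], continuous x}, x t0 = xs
      t0,
      forall t, t \in `[t0, t1] -> `|x t - xs t| <= C * (sigma - tau) &
      forall i, primitive_off t0 t1 (tau :: sigma :: s) (fun t => x t 0 i)
        (fun t => phi t (x t) (needle tau sigma v us t) 0 i)].
Proof.
move=> t01 gamma0 cxs Hphi pus dxs.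
have g2 : gamma / 2 < gamma by rewrite ltr_pdivrMr// ltr_pMr// ltr1n.
have g20 : 0 <= gamma / 2 by rewrite divr_ge0// ltW.
have [M0 M00 HM0] := pc_off_bounded pus.
pose M := Num.max M0 `|v|.
have usM tau sigma t : t \in `[t0, t1] -> `|needle tau sigma v us t| <= M.
  move=> tI; rewrite /needle; case: ifP => _; rewrite le_max ?lexx ?orbT//.
  by rewrite HM0.
have usM' t : t \in `[t0, t1] -> `|us t| <= M by move=> tI; rewrite le_max HM0.
have [L L0 HL] : exists2 L : R, 0 < L & forall j t x y u, t \in `[t0, t1] ->
    `|x - xs t| <= gamma / 2 -> `|y - xs t| <= gamma / 2 -> `|u| <= M ->
    `|phi t x u 0 j - phi t y u 0 j| <= L * `|x - y|.
  apply: fin_upper => [j|j B B' BB' h t x y u tI xg yg uM].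
    by have [L L0 HL] := tube_lipschitz cxs (C0_C1x_on_coord j Hphi) M g2;
      exists L.
  by apply: le_trans (h t x y u tI xg yg uM) _; rewrite ler_wpM2r.
have [B B0 HB] := let: And3 c _ _ := Hphi in tube_bounded cxs M g2 c.
pose E := expR (2 * L * (t1 - t0)).
(* On the needle the two right-hand sides differ by at most [2 * B], so the first Picard step is at
   most [2 * B * (sigma - tau)]; [picard] contributes another factor 2 and [E]. *)
exists (4 * B * E); first by rewrite !mulr_gt0// expR_gt0.
move=> tau sigma t0tau ts st1 small; set w := needle tau sigma v us.
pose F t y := phi t (xs t + clamp (gamma / 2) (y - xs t)) (w t).
have pw : pc_off t0 t1 (tau :: sigma :: s) w by exact: pc_off_needle.
have HF x : {within `[t0, t1], continuous x} ->
    forall i, bounded_continuous_off t0 t1 (tau :: sigma :: s) (fun t =>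
      F t (x t) 0 i).
  move=> cx i; apply: pc_off_bounded_continuous_off; apply: pc_off_coord.
  have [cphi _ _] := Hphi.
  apply: (pc_off_tube cxs cphi (x :=
    fun t => xs t + clamp (gamma / 2) (x t - xs t))) => //.
    move/subspace_continuousP: cx => cx; move/subspace_continuousP: cxs => cxs'.
    apply/subspace_continuousP => t tI; apply: cvgD; first exact: cxs'.
    have dcvg : (fun t => x t - xs t) @ within `[t0, t1] (nbhs t) --> x t - xs
      t.
      by apply: cvgB; [exact: cx|exact: cxs'].
    apply: (cvg_comp _ _ dcvg); exact: clamp_continuous.
  by move=> t _; rewrite addrC addKr (le_lt_trans _ g2)// clamp_le.
have HLF t : t \in `[t0, t1] -> forall x y, `|F t x - F t y| <= L * `|x - y|.
  move=> tI x y; apply: rV_norm_le => [|i]; first by rewrite mulr_ge0// ltW.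
  rewrite rVBE (le_trans (HL i t _ _ (w t) tI _ _ _))//.
  - by rewrite addrC addKr clamp_le.
  - by rewrite addrC addKr clamp_le.
  - exact: usM.
  rewrite ler_pM2l// opprD addrACA subrr add0r (le_trans (clamp_lipschitz _ _
    _))//.
  by rewrite opprB addrA subrK.
have Fxs t : F t (xs t) = phi t (xs t) (w t).
  by rewrite /F subrr clamp_id ?normr0// addr0.
have t0I : t0 \in `[t0, t1] by rewrite in_itv/= lexx ltW.
have sgP t : t \in `[t0, t1] -> 0 <= 1 * (t - t0).
  by rewrite in_itv/= mul1r subr_ge0 => /andP[].
have phiB t u : t \in `[t0, t1] -> `|u| <= M -> forall i, `|phi t (xs t) u 0 i|
  <= B.
  move=> tI uM i; apply: le_trans (le_rV_norm _ i) _;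
    apply: (HB t (xs t) u) => //.
  by rewrite subrr normr0.
have [|t i tI|x [cx xt0 dx xC]] :=
  @picard R n t0 t1 (tau :: sigma :: s) F L t0 1
    (xs t0) L0 t0I (mulr1 1) sgP HF HLF xs (2 * B * (sigma - tau)) _ cxs.
- by rewrite mulr_ge0 ?mulr_ge0 ?(ltW B0)// subr_ge0 ltW.
- rewrite integral_from_base subr0.
  set I := integral_from _ _.
  (* [xs] is itself an antiderivative for the control [us], so the first Picard step integrates a
     difference that vanishes off the needle. *)
  have pI : primitive_off t0 t1 (tau :: sigma :: s) (I \- (fun t => xs t 0 i))
      ((fun r => F r (xs r) 0 i) \- (fun r => phi r (xs r) (us r) 0 i)).
    apply: primitive_offB;
      first exact: integral_from_primitive (ltW t01) (HF _ cxs i).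
    by apply: primitive_off_sub (dxs i) => r rs; rewrite !inE rs !orbT.
  have -> : xs t0 0 i + I t - xs t 0 i =
      (I \- (fun t => xs t 0 i)) t - (I \- (fun t => xs t 0 i)) t0.
    by rewrite /= /I integral_from_base; ring.
  apply: (primitive_off_needle_norm_le (ltW t0tau) (ltW ts) tI _ pI).
    by rewrite mulr_ge0// ltW.
  move=> r rI _ /=; rewrite Fxs /w /needle.
  have {}rI : r \in `[t0, t1] by rewrite in_itv/=;
    case/andP: rI => /ltW-> /ltW->.
  case: ifP => _; last by rewrite subrr normr0.
  rewrite (le_trans (ler_normB _ _))// mulr2n mulrDl mul1r lerD// phiB//;
    last exact: usM'.
  by rewrite le_max lexx orbT.
have xC' t : t \in `[t0, t1] -> `|x t - xs t| <= 4 * B * E * (sigma - tau).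
  move=> tI; apply: le_trans (xC t tI) _; rewrite -/E.
  by rewrite le_eqVlt; apply/orP; left; apply/eqP; ring.
exists x; split => // i.
have [cxi dxi] := dx i; split => // t tI tns.
(* The smallness of the needle keeps [x] where the clamp is the identity, so [x] solves the original
   equation. *)
have := dxi t tI tns; rewrite /F clamp_id ?subrKC//.
apply: le_trans small; apply: xC'.
by rewrite in_itv/=; case/andP: tI => /ltW-> /ltW->.
Qed.

(** * The maximum condition *)

Lemma primitive_offM (R : realType) (a b : R) s (G H g h : R -> R) :
  primitive_off a b s G g -> primitive_off a b s H h ->
  primitive_off a b s (fun t => G t * H t) (fun t => g t * H t + G t * h t).
Proof.
move=> [cG dG] [cH dH]; split.
  by move=> x; apply: continuousM; [exact: cG|exact: cH].
move=> t tab ts; have dGt := dG t tab ts; have dHt := dH t tab ts.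
apply: (is_derive_eq (is_deriveM dGt dHt)).
by rewrite /GRing.scale/=; ring.
Qed.

Lemma primitive_off_sum (R : realType) (k : nat) (a b : R) s (G g : 'I_k -> R
  -> R) :
  (forall i, primitive_off a b s (G i) (g i)) ->
  primitive_off a b s (fun t => \sum_i G i t) (fun t => \sum_i g i t).
Proof.
move=> pG; split.
  apply/subspace_continuousP => t tI; apply: cvg_big => [|i _].
    exact: add_continuous.
  by have [/subspace_continuousP cG _] := pG i; exact: cG.
move=> t tab ts.
have dG i : is_derive t 1 (G i) (g i t) by have [_] := pG i; exact.
have := is_derive_sum dG; congr (is_derive _ _ _ _).
by apply/funext => r; rewrite fct_sumE.
Qed.

Lemma primitive_off_eq (R : realType) (a b : R) s (G g h : R -> R) :
  (forall t, t \in `[a, b] -> g t = h t) ->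
  primitive_off a b s G g -> primitive_off a b s G h.
Proof.
move=> gh [cG dG]; split=> // t tab ts; rewrite -gh; first exact: dG.
by rewrite in_itv/=; case/andP: tab => /ltW-> /ltW->.
Qed.

Lemma PC1_primitive_off (R : realType) (k : nat) (a b : R) (x xdot : R ->
  'rV[R]_k) :
  PC1 a b x xdot -> {within `[a, b], continuous x} /\
  exists s, (forall t, t \in s -> a < t < b) /\
    forall i, primitive_off a b s (fun t => x t 0 i) (fun t => xdot t 0 i).
Proof.
move=> px; split.
  apply/subspace_continuousP => t tI; apply/cvg_rVP => i.
  by have [/subspace_continuousP cx _] := px i; exact: cx.
have /choice[s sP] := fun i => (px i).2.
exists (flatten [seq s i | i <- enum 'I_k]); split.
  move=> t /flatten_mapP[i _ ti]; have [[sab _ _] _] := sP i; exact: sab.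
move=> i; apply: (@primitive_off_sub _ _ _ (s i)).
  by move=> t ti; apply/flatten_mapP; exists i; rewrite ?mem_enum.
split; first by case: (px i).
by have [_] := sP i.
Qed.

Lemma pc_off_PC1 (R : realType) (k : nat) (a b : R) s (x xdot : R -> 'rV[R]_k) :
  pc_off a b s xdot ->
  (forall i, primitive_off a b s (fun t => x t 0 i) (fun t => xdot t 0 i)) ->
  PC1 a b x xdot.
Proof.
move=> pd px i; have [cx dx] := px i; split => //; exists s; split => //.
exact: (pc_off_coord i pd).
Qed.

Lemma pc_off_cat (R : realType) (V : normedModType R) (a b : R) s s' (g : R ->
  V) :
  (forall t, t \in s' -> a < t < b) -> pc_off a b s g -> pc_off a b (s ++ s') g.
Proof.
move=> s'ab pg; apply: (pc_off_sub _ _ pg) => [t ts|t];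
  first by rewrite mem_cat ts.
by rewrite mem_cat => /orP[|]; [case: pg => + _ _; exact|exact: s'ab].
Qed.

Lemma pc_off_cst (R : realType) (V : normedModType R) (a b : R) s (v : V) :
  (forall t, t \in s -> a < t < b) -> pc_off a b s (cst v).
Proof.
move=> sab; split=> // [t _ _|t _]; first exact: cvg_cst.
by split; [exact: is_cvg_cst|exact: cvg_cst].
Qed.

(** Viewed as constant in [t] and [u], the terminal cost gets its first-order expansion at [xs t1]
    from the tube estimates. *)
Lemma C0_C1x_on_terminal (R : realType) (n m : nat) (A : set (R * 'rV[R]_n *
  'rV[R]_m))
    (S : 'rV[R]_n -> R) : continuously_differentiable S ->
  C0_C1x_on A (fun _ y _ => S y).
Proof.
move=> [dS cS].
have c12 (z : R * 'rV[R]_n * 'rV[R]_m) : r.1.2 @[r --> within A (nbhs z)] -->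
  z.1.2.
  have Fz : r @[r --> within A (nbhs z)] --> z by exact: cvg_within.
  have F1 : r.1 @[r --> within A (nbhs z)] --> z.1 by move=> B nB;
    exact: (Fz _ (cvg_fst nB)).
  by move=> B nB; exact: (F1 _ (cvg_snd nB)).
split.
- apply/subspace_continuousP => z Az.
  have cSz : S y @[y --> z.1.2] --> S z.1.2.
    by apply: differentiable_continuous; exact: dS.
  exact: (cvg_comp _ _ (c12 z) cSz).
- by move=> t y u _; exact: dS.
- move=> i; apply/subspace_continuousP => z Az.
  have cD : 'D_(delta_mx 0 i) S y @[y --> nbhs z.1.2] --> 'D_(delta_mx 0 i) S
    z.1.2.
    have /cvg_rVP/(_ i) := cS z.1.2; rewrite mxE.
    by under eq_fun do rewrite mxE.
  exact: (cvg_comp _ _ (c12 z) cD).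
Qed.

Lemma common_small (R : realType) (l : seq R) : (forall r, r \in l -> 0 < r) ->
  exists2 h : R, 0 < h & forall r, r \in l -> h < r.
Proof.
elim: l => [|a l IH] l0; first by exists 1.
have [|h h0 hl] := IH; first by move=> r rl; apply: l0; rewrite inE rl orbT.
have a0 : 0 < a by apply: l0; rewrite inE eqxx.
exists (Num.min h (a / 2)); first by rewrite lt_min h0 divr_gt0.
move=> r; rewrite inE => /orP[/eqP->|/hl hr]; rewrite gt_min ?hr//.
by apply/orP; right; lra.
Qed.

Section maximum_principle.
Context {R : realType} {n m : nat} (t0 t1 : R) (x0 : 'rV[R]_n) (U : set
  'rV[R]_m)
  (f : R -> 'rV[R]_n -> 'rV[R]_m -> R)
  (phi : R -> 'rV[R]_n -> 'rV[R]_m -> 'rV[R]_n) (S : 'rV[R]_n -> R)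
  (xs : R -> 'rV[R]_n) (us : R -> 'rV[R]_m) (gamma : R) (s : seq R).
Hypotheses (t01 : t0 < t1) (gamma0 : 0 < gamma)
  (cxs : {within `[t0, t1], continuous xs}).
Notation T := (@tube R n m t0 t1 xs gamma).
Hypotheses (Hf : C0_C1x_on T f) (Hphi : C0_C1x_on T phi)
  (pus : pc_off t0 t1 s us)
  (dxs : forall i, primitive_off t0 t1 s (fun t => xs t 0 i)
               (fun t => phi t (xs t) (us t) 0 i)).
Variable p : R -> 'rV[R]_n.
Let H t y u := pontryagin f phi t y u (p t).
Let pdot t := - grad (fun y => H t y (us t)) (xs t).
Hypotheses (cp : {within `[t0, t1], continuous p})
  (pt1 : p t1 = - grad S (xs t1))
  (dp : forall i, primitive_off t0 t1 s (fun t => p t 0 i) (fun t =>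
    pdot t 0 i)).

Let tI0 : t0 \in `[t0, t1]. Proof. by rewrite in_itv/= lexx ltW. Qed.
Let tI1 : t1 \in `[t0, t1]. Proof. by rewrite in_itv/= lexx ltW. Qed.
Let center t : t \in `[t0, t1] -> `|xs t - xs t| < gamma.
Proof. by rewrite subrr normr0. Qed.

(* Integrating [<p, x - xs>'] turns the increment of the cost into the
   increment of [Theta], whose density only involves the Pontryagin function. *)
Lemma cost_increment s' (x : R -> 'rV[R]_n) (w : R -> 'rV[R]_m) :
  {subset s <= s'} -> pc_off t0 t1 s' w -> {within `[t0, t1], continuous x} ->
  x t0 = xs t0 -> (forall t, t \in `[t0, t1] -> `|x t - xs t| < gamma) ->
  (forall i, primitive_off t0 t1 s' (fun t => x t 0 i)
               (fun t => phi t (x t) (w t) 0 i)) ->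
  exists Theta, primitive_off t0 t1 s' Theta (fun t =>
      \sum_i grad (fun y => H t y (us t)) (xs t) 0 i * (x t - xs t) 0 i
      - (H t (x t) (w t) - H t (xs t) (us t))) /\
    J t0 t1 f S (x, w) - J t0 t1 f S (xs, us) = Theta t1 - Theta t0
      + (S (x t1) - S (xs t1) - \sum_i grad S (xs t1) 0 i * (x t1 - xs t1) 0 i).
Proof.
move=> ss pw cx xt0 xg dx.
have [cf _ _] := Hf.
have bfx := pc_off_bounded_continuous_off (pc_off_tube cxs cf cx xg pw).
have bfs := pc_off_bounded_continuous_off (pc_off_tube cxs cf cxs center pus).
have Ifx := integral_from_primitive (ltW t01) bfx.
have Ifs := primitive_off_sub ss (integral_from_primitive (ltW t01) bfs).
have Ip := primitive_off_sum (fun i =>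
  primitive_offM (primitive_off_sub ss (dp i))
  (primitive_offB (dx i) (primitive_off_sub ss (dxs i)))).
have := primitive_offB (primitive_offB Ifx Ifs) Ip;
  set Theta := (X in primitive_off _ _ _ X) => pT.
exists Theta; split.
  apply: primitive_off_eq pT => t tI /=.
  rewrite /H /pontryagin big_split/= /pdot.
  have -> : \sum_(i < n) (- grad (fun y =>
    H t y (us t)) (xs t)) 0 i * (x t 0 i - xs t 0 i) =
    - \sum_i grad (fun y => H t y (us t)) (xs t) 0 i * (x t - xs t) 0 i.
    by rewrite -sumrN; apply: eq_bigr => i _; rewrite rVBE mxE mulNr.
  rewrite -/(H _ _ _).
  under [X in - (- _ + X)]eq_bigr do rewrite mulrBr.
  rewrite sumrB /H /pontryagin; ring.
(* The boundary term vanishes at [t0], where the trajectories agree; at [t1] transversality turns it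
   into minus the linear part of the increment of [S]. *)
rewrite /Theta /= !integral_from_base xt0.
rewrite (_ : \sum_i p t0 0 i * _ = 0); last by apply: big1 => i _;
  rewrite subrr mulr0.
rewrite (_ : \sum_i p t1 0 i * _ =
    - \sum_i grad S (xs t1) 0 i * (x t1 - xs t1) 0 i); last first.
  by rewrite pt1 -sumrN; apply: eq_bigr => i _; rewrite rVBE mxE mulNr.
by rewrite /J/= /integral_from; ring.
Qed.

Hypotheses (hS : continuously_differentiable S) (xs0 : xs t0 = x0)
  (usU : forall t, t \in `[t0, t1] -> U (us t))
  (hmin : strong_local_minimum t0 t1 x0 U f phi S (xs, us)).

Lemma pontryagin_maximum tau v : t0 < tau < t1 -> tau \notin s -> U v ->
  H tau (xs tau) v <= H tau (xs tau) (us tau).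
Proof.
move=> /andP[t0tau taut1] taus Uv; rewrite leNgt; apply/negP => Hlt.
pose c := H tau (xs tau) v - H tau (xs tau) (us tau).
have c0 : 0 < c by rewrite subr_gt0.
have HH := pontryagin_C0_C1x Hf Hphi cp.
have [cH _ _] := HH; have [cphi _ _] := Hphi.
have [sI _ _] := pus.
have pcH (u : R -> 'rV[R]_m) : pc_off t0 t1 s u ->
    {for tau, continuous (fun t => H t (xs t) (u t))}.
  move=> pu; apply: (pc_off_continuous (pc_off_tube cxs cH cxs center pu)) =>
    //.
  by rewrite t0tau.
(* Since [tau] is not in [s], the excess [c] varies continuously at [tau], and at least half of it
   persists on a short needle. *)
have [r0 r00 Hr0] : exists2 r0 : R, 0 < r0 & forall t, tau <= t < tau + r0 ->
    c / 2 <= H t (xs t) v - H t (xs t) (us t).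
  have : (fun t => H t (xs t) v - H t (xs t) (us t)) @ tau --> c.
    by apply: cvgB; [exact: (pcH (cst v) (pc_off_cst v sI))|exact: pcH].
  have c2 : c / 2 < c by lra.
  move=> /cvgr_ge/(_ _ c2)/nbhs_ballP[r0 /= r00 Hr0];
    exists r0 => // t /andP[h1 h2].
  by apply: Hr0; rewrite /ball/= distrC ger0_norm ?subr_ge0// ltrBlDl.
have [C C0 HC] := needle_trajectory v t01 gamma0 cxs Hphi pus dxs.
have [M0 M00 HM0] := pc_off_bounded pus.
pose M := Num.max M0 `|v|.
have usM t : t \in `[t0, t1] -> `|us t| <= M by move=> tI; rewrite le_max HM0.
have vM : `|v| <= M by rewrite le_max lexx orbT.
have g2 : gamma / 2 < gamma by rewrite ltr_pdivrMr// ltr_pMr// ltr1n.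
have [L L0 HL] := tube_lipschitz cxs HH M g2.
(* Chosen so that the remainders over [[t0, t1]] and the terminal remainder together cost at most
   [c / 8 * h], as [etaE] records; the 1 in [t1 - t0 + 1] accounts for the terminal one. *)
pose eta := c / (8 * (C * (t1 - t0 + 1))).
have CE0 : 0 < C * (t1 - t0 + 1) by rewrite mulr_gt0// ltr_wpDl// subr_ge0 ltW.
have eta0 : 0 < eta by rewrite divr_gt0// mulr_gt0.
have etaE : eta * C * (t1 - t0) + eta * C = c / 8.
  by rewrite /eta; field; rewrite !gt_eqF// ltr_wpDl// subr_ge0 ltW.
have [dH dH0 HdH] := tube_uniformly_differentiable cxs gamma0 HH M eta0.
have [dS dS0 HdS] := tube_uniformly_differentiable cxs gamma0
  (C0_C1x_on_terminal T hS) M eta0.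
have [eps [eps0 Heps]] := hmin.
(* On the needle two changes from [xs] to [x], under [v] and under [us], cost [L * (C * h)] each,
   and the remainder costs [eta * (C * h)]. *)
pose K := (2 * L + eta) * C.
have K0 : 0 < K by rewrite mulr_gt0// addr_gt0// mulr_gt0.
(* In order: the needle ends before [t1], the excess persists on it, the trajectory exists, the two
   expansions apply, [x] competes with [xs], and the error on the needle is below [c / 8]. *)
have [|h h0 hl] := @common_small R [:: t1 - tau; r0; gamma / 2 / C; dH / C;
  dS / C; eps / C; c / 8 / K].
  move=> r; rewrite !inE =>
    /or4P[/eqP->|/eqP->|/eqP->|/or4P[/eqP->|/eqP->|/eqP->|/eqP->]] //;
    rewrite ?subr_gt0//; repeat apply: divr_gt0 => //.
have {hl} [h1 h2 h3 [h4 h5 h6 h7]] : [/\ tau + h < t1, h < r0, C * h <= gamma /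
  2 &
    [/\ C * h < dH, C * h < dS, C * h < eps & K * h < c / 8]].
  have CM r : h < r / C -> C * h < r by move=> hr; rewrite mulrC -ltr_pdivlMr.
  have KM r : h < r / K -> K * h < r by move=> hr; rewrite mulrC -ltr_pdivlMr.
  split; last split; rewrite ?(CM, KM) ?ltW ?CM//; try (by apply: hl;
    rewrite !inE eqxx ?orbT).
  by rewrite -ltrBrDl; apply: hl; rewrite !inE eqxx.
pose sigma := tau + h; have sE : sigma - tau = h by rewrite /sigma addrC addKr.
have ts : tau < sigma by rewrite ltrDl.
have [|x [cx xt0 xC dx]] := HC tau sigma t0tau ts h1; first by rewrite sE.
rewrite sE in xC; set w := needle tau sigma v us in dx.
have xg t : t \in `[t0, t1] -> `|x t - xs t| < gamma.
  by move=> tI; rewrite (le_lt_trans (xC t tI))// (le_lt_trans h3).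
have pw : pc_off t0 t1 (tau :: sigma :: s) w by exact: pc_off_needle.
have adm : A_adm t0 t1 x0 U phi (x, w).
  split => /=.
  - exists (fun t => phi t (x t) (w t)); split => //.
    exact: pc_off_PC1 (pc_off_tube cxs cphi cx xg pw) dx.
  - by rewrite xt0.
  - exact: pc_off_PC pw.
  - by move=> t tI; rewrite /w /needle; case: ifP => _ //; exact: usU.
have Jle : J t0 t1 f S (xs, us) <= J t0 t1 f S (x, w).
  apply: Heps => //=; apply: le_lt_trans h6; rewrite /sup_norm; apply: ge_sup.
    by exists `|x t0 - xs t0|; exists t0.
  by move=> _ [t /= tI <-]; exact: xC.
have [|Theta [pT JT]] := cost_increment _ pw cx xt0 xg dx.
  by move=> t ts'; rewrite !inE ts' !orbT.
have etaD t : t \in `[t0, t1] -> eta * `|x t - xs t| <= eta * (C * h).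
  by move=> tI; rewrite ler_pM2l// xC.
have LD t : t \in `[t0, t1] -> L * `|x t - xs t| <= L * (C * h).
  by move=> tI; rewrite ler_pM2l// xC.
have Tle : Theta t1 - Theta t0 <= eta * (C * h) * (t1 - t0) + (- (c / 2) + K *
  h) * h.
  rewrite -{3}sE; apply: (primitive_off_needle_le (ltW t0tau) (ltW ts) (ltW h1)
    _ pT).
    exact: ltW (mulr_gt0 eta0 (mulr_gt0 C0 h0)).
  move=> t tI _; have {}tI : t \in `[t0, t1].
    by rewrite in_itv/=; case/andP: tI => /ltW-> /ltW->.
  have := HdH t (x t) (us t) tI (le_lt_trans (xC t tI) h4) (usM t tI).
  move=> /le_trans/(_ (etaD t tI));
    rewrite -/(H _ _ _) -/(H _ _ _) ler_norml => /andP[d1 d2].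
  rewrite /w /needle; case: ifP => [tn|_]; last by move: d1;
    rewrite -/(H _ _ _); lra.
  have cx' : `|x t - xs t| <= gamma / 2 by exact: le_trans (xC t tI) h3.
  have cs' : `|xs t - xs t| <= gamma / 2 by rewrite subrr normr0 divr_ge0 ?ltW.
  have := le_trans (HL t (x t) (xs t) v tI cx' cs' vM) (LD t tI).
  have := le_trans (HL t (x t) (xs t) (us t) tI cx' cs' (usM t tI)) (LD t tI).
  rewrite !ler_norml => /andP[e1 e2] /andP[e3 e4].
  have := Hr0 t; case/andP: tn => tn1 tn2;
    rewrite tn1 (lt_trans tn2) ?ltrD2l// => /(_ isT) e5.
  have KE : K * h = 2 * (L * (C * h)) + eta * (C * h) by rewrite /K; ring.
  rewrite KE; move: d1 d2 e1 e2 e3 e4 e5; rewrite /H; lra.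
(* [v] is a dummy here, as [S] ignores the control: any vector of norm at most [M] would do. *)
have := HdS t1 (x t1) v tI1 (le_lt_trans (xC t1 tI1) h5) vM.
move=> /le_trans/(_ (etaD t1 tI1)); rewrite ler_norml => /andP[_ dSle].
(* The cost changes by at most this amount, and [K * h < c / 8] makes it less than [- h * c / 4],
   contradicting minimality. *)
have key : 0 <= h * (c / 8 - c / 2 + K * h).
  have -> : h * (c / 8 - c / 2 + K * h) =
    (eta * (C * h) * (t1 - t0) + (- (c / 2) + K * h) * h) + eta * (C * h).
    by rewrite -etaE; ring.
  by move: Jle JT Tle dSle; rewrite -subr_ge0; lra.
by move: key; rewrite pmulr_rge0//; lra.
Qed.

End maximum_principle.

Unset Implicit Arguments.

Theorem theorem1p2 (R : realType) (n m : nat) (t0 t1 : R) (ht : t0 < t1)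
    (x0 : 'rV[R]_n) (U : set 'rV[R]_m) (hU : U !=set0)
    (f : R -> 'rV[R]_n -> 'rV[R]_m -> R)
    (phi : R -> 'rV[R]_n -> 'rV[R]_m -> 'rV[R]_n)
    (S : 'rV[R]_n -> R) (hS : continuously_differentiable S)
    (xs : R -> 'rV[R]_n) (us : R -> 'rV[R]_m)
    (hxu : (A_adm t0 t1 x0 U phi `&` A_Lip t0 t1 f phi) (xs, us))
    (hmin : strong_local_minimum t0 t1 x0 U f phi S (xs, us)) :
  exists p pdot : R -> 'rV[R]_n,
    [/\ PC1 t0 t1 p pdot,
        forall t, t \in `[t0, t1] ->
          pdot t = - grad (fun x => pontryagin f phi t x (us t) (p t)) (xs t),
        p t1 = - grad S (xs t1)
      & {ae (@lebesgue_measure R), forall t, t \in `[t0, t1] ->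
          is_maximum [set pontryagin f phi t (xs t) u (p t) | u in U]
            (pontryagin f phi t (xs t) (us t) (p t))}].
Proof.
have [[[xdot [pxs xdotE] xs0 pcus usU]] [gamma [gamma0 /= [Hf Hphi]]]] := hxu.
have [cxs [sx [sxI dx]]] := PC1_primitive_off pxs.
have [su psu] := PC_pc_off pcus.
pose s := su ++ sx.
have pus : pc_off t0 t1 s us by exact: pc_off_cat.
have dxs i : primitive_off t0 t1 s (fun t => xs t 0 i) (fun t =>
  phi t (xs t) (us t) 0 i).
  apply: (@primitive_off_eq _ _ _ _ _ (fun t => xdot t 0 i)).
    by move=> t tI; rewrite xdotE.
  by apply: primitive_off_sub (dx i) => t tsx; rewrite mem_cat tsx orbT.
have [p [cp pt1 pcp dp]] :=
  adjoint_exists cxs gamma0 Hf Hphi (ltW ht) (- grad S (xs t1)) pus.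
exists p, (fun t => - grad (fun x => pontryagin f phi t x (us t) (p t)) (xs t)).
split => //; first exact: pc_off_PC1 pcp dp.
(* A needle needs room on both sides of [tau] and continuity of the control there, so the two end
   points are discarded along with [s]. *)
have null : (@lebesgue_measure R).-negligible [set` [:: t0, t1 & s]].
  have fs : finite_set [set` [:: t0, t1 & s]] by exact: finite_seq.
  apply/negligibleP; last
    exact/countable_lebesgue_measure0/finite_set_countable.
  apply: countable_measurable; first by move=> t; exact: measurable_set1.
  exact: finite_set_countable.
apply: negligibleS null => t /= nmax; apply/negPn/negP; rewrite !inE !negb_or.
move=> /and3P[tt0 tt1 ts]; apply: nmax => tI; split;
  first by exists (us t) => //; exact: usU.
move=> _ [v Uv <-].
apply: (pontryagin_maximum ht gamma0 cxs Hf Hphi pus dxs cp pt1 dp hS xs0 usU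
  hmin) => //.
by move: tI; rewrite in_itv/= !lt_neqAle eq_sym tt0 tt1.
Qed.
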